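(* Let $\omega\ge 2$ be an integer, let $G$ be a circle graph with clique number at most $\omega$, and let $\mathcal{I}$ be an interval system with overlap graph $G$. Let $(P,\preceq, \psi)$ be a pillar assignment of $\mathcal{I}$ such that $\chi(P,\preceq, \psi) \le 2\omega \log_2 (\omega) +2\omega \log_2(\log_2 (\omega)) + 10\omega$, and $d_{(P,\preceq, \psi)}(K)\le \omega \log_2 (\omega) + \omega \log_2(\log_2 (\omega)) + 6\omega$ for every arch $K$ of $(P,\preceq, \psi)$. Then there is a complete pillar assignment $(P^*,\preceq^*, \psi^* )$ of $\mathcal{I}$ extending $(P,\preceq, \psi)$ with $\chi(P^*,\preceq^*, \psi^* ) \le 2\omega\log_2 (\omega) +2\omega \log_2(\log_2 (\omega)) + 10\omega$.
   Context: An interval system is a finite collection $\mathcal I$ of open intervals contained in $(0,1)$ such that no two share an endpoint. For an interval $I$, $\ell(I)$, $r(I)$ are its left and right endpoints. Two distinct intervals overlap if they intersect and neither contains the other. The overlap graph of $\mathcal I$ has vertex set $\mathcal I$, with two intervals adjacent when they overlap; circle graphs are exactly such overlap graphs. For a set $\mathcal X$ of intervals, $\omega(\mathcal X)$ is the maximum size of a subset of pairwise overlapping intervals ($0$ if empty). A proper partial colouring of $\mathcal I$ is a map from a subset of $\mathcal I$ to the positive integers giving no two overlapping intervals the same colour. Structured colourings: if $\mathcal X\subseteq\mathcal I$ is a set of intervals all containing a common point and $C$ is a set of positive integers with $|C|=\omega(\mathcal X)$, a proper colouring $\phi:\mathcal X\to C$ is structured if (i) whenever $I_1,\dots,I_k\in\mathcal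 X$ satisfy $\phi(I_1)<\dots<\phi(I_k)$ and $\ell(I_1)<\dots<\ell(I_k)$, there are $k$ pairwise overlapping $I_1^*,\dots,I_k^*\in\mathcal X$ with all $\ell(I_j^* )\in[\ell(I_1),\ell(I_k)]$, and (ii) the same holds with $r$ in place of $\ell$ throughout. A pillar of $\mathcal I$ is a point of $(0,1)$ that is not an endpoint of any interval of $\mathcal I$. Let $P$ be a finite set of pillars totally ordered by $\preceq$. An interval $I\in\mathcal I$ is assigned to $p\in P$ if $p\in I$ and $I$ contains no $p'\in P$ with $p'\prec p$; $\mathcal I_p$ is the set of intervals assigned to $p$. The foundation $F_p$ is the open interval containing $p$, with endpoints in $\{p'\in P:p'\prec p\}\cup\{0,1\}$, containing no pillar $p'\prec p$; $\mathcal F_p$ is the set of intervals of $\mathcal I$ with exactly one endpoint in $F_p$. A pillar assignment is a triple $(P,\preceq,\psi)$ with $\psi=\bigcup_{p\in P}\phi_p$, where in $\preceq$-order, with $\psi_{\prec p}=\bigcup_{p'\prec p}\phi_{p'}$, $C_p$ is the set of the $\omega(\mathcal I_p)$ smallest positive integers not in $\psi_{\prec p}(\mathcal F_p)$ and $\phi_p:\mathcal I_p\to C_p$ is a structured colouring. It is complete if every interval of $\mathcal I$ contains a pillar of $P$. $\chi(P,\preceq,\psi)=|\psi(\mathcal I)|$ is the number of colours used. An arch of $(P,\preceq,\psi)$ is an open interval whose endpoints lie in $\{0,1\}\cup P$ and which contains no pillar of $P$. For an open interval $J$ contained in an arch, the degree $d_{(P,\preceq,\psi)}(J)$ is the number of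 distinct colours $\psi(I)$ taken over the intervals $I\in\mathcal I$ coloured by $\psi$ that have an endpoint in $J$. A pillar assignment $(P^*,\preceq^*,\psi^* )$ extends $(P,\preceq,\psi)$ if $P\subseteq P^*$, every pillar of $P$ precedes every pillar of $P^*\setminus P$ in $\preceq^*$, the restriction of $\preceq^*$ to $P$ is $\preceq$, and $\psi^*$ extends $\psi$. *)

(* Defs.v *)
From HB Require Import structures.
From mathcomp Require Import all_boot all_order all_algebra finmap.
From mathcomp Require Import all_classical all_reals all_analysis.

Set Implicit Arguments.
Unset Strict Implicit.
Unset Printing Implicit Defensive.

Import Order.TTheory GRing.Theory Num.Theory.

Local Open Scope fset_scope.
Local Open Scope fmap_scope.
Local Open Scope ring_scope.

Record sgraph := SGraph {
  vertex :> finType;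
  adj : rel vertex;
  adj_sym : symmetric adj;
  adj_irrefl : irreflexive adj
}.

Definition graph_iso (G H : sgraph) : Prop :=
  exists2 f : G -> H, bijective f & forall x y, adj (f x) (f y) = adj x y.

Definition is_clique (G : sgraph) (K : {set G}) : bool :=
  [forall x in K, forall y in K, (x != y) ==> adj x y].

Definition clique_number (G : sgraph) : nat :=
  \max_(K : {set G} | is_clique K) #|K|.

Section Intervals.
Variable R : realType.

(* The pair (l, r) stands for the open interval ]l, r[.  As only pairs with
   l < r are used, distinct pairs are distinct intervals. *)
Definition oitv (I : R * R) : interval R := `]I.1, I.2[.

Definition endpoints (I : R * R) : {fset R} := [fset I.1; I.2].

Definition overlap (I J : R * R) : Prop :=
  [/\ I != J,
      ([set` oitv I] `&` [set` oitv J] !=set0)%classic,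
      ~ ([set` oitv I] `<=` [set` oitv J])%classic &
      ~ ([set` oitv J] `<=` [set` oitv I])%classic].

Lemma overlap_sym (I J : R * R) : overlap I J -> overlap J I.
Proof. by case=> IJ IJ0 nIJ nJI; split; rewrite // 1?eq_sym // setIC. Qed.

Definition interval_system (Is : {fset R * R}) : Prop :=
  {in Is, forall I, [&& 0 <= I.1, I.1 < I.2 & I.2 <= 1]} /\
  {in Is &, forall I J, I != J -> [disjoint endpoints I & endpoints J]}.

Definition overlap_rel (Is : {fset R * R}) : rel Is :=
  fun I J => `[< overlap (val I) (val J) >].

Lemma overlap_rel_sym (Is : {fset R * R}) : symmetric (@overlap_rel Is).
Proof. by move=> I J; apply/asboolP/asboolP; apply: overlap_sym. Qed.

Lemma overlap_rel_irrefl (Is : {fset R * R}) : irreflexive (@overlap_rel Is).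
Proof. by move=> I; apply/asboolP => -[]; rewrite eqxx. Qed.

Definition overlap_graph (Is : {fset R * R}) : sgraph :=
  SGraph (@overlap_rel_sym Is) (@overlap_rel_irrefl Is).

Definition circle_graph (G : sgraph) : Prop :=
  exists2 Is : {fset R * R}, interval_system Is & graph_iso G (overlap_graph Is).

Definition pairwise_overlapping (Y : {fset R * R}) : Prop :=
  {in Y &, forall I J, I != J -> overlap I J}.

Definition omega (X : {fset R * R}) : nat :=
  \max_(Y <- fpowerset X | `[< pairwise_overlapping Y >]) #|` Y|.

Definition proper_colouring (phi : {fmap R * R -> nat}) : Prop :=
  forall I J : domf phi, overlap (val I) (val J) -> phi I != phi J.

(* Conditions (i) and (ii) of structured colourings are the instances e = fst
   and e = snd.  Families of k intervals are indexed by 'I_k.+1 to have k > 0;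
   the members of Js are distinct because overlap is irreflexive. *)
Definition structured_along (e : R * R -> R) (phi : {fmap R * R -> nat}) :
    Prop :=
  forall (k : nat) (J : 'I_k.+1 -> domf phi),
    (forall i j : 'I_k.+1, (i < j)%N -> (phi (J i) < phi (J j))%N) ->
    (forall i j : 'I_k.+1, (i < j)%N -> e (val (J i)) < e (val (J j))) ->
  exists Js : 'I_k.+1 -> domf phi,
    (forall i j : 'I_k.+1, i != j -> overlap (val (Js i)) (val (Js j))) /\
    (forall i, e (val (Js i)) \in
                 `[e (val (J ord0)), e (val (J ord_max))]).

Definition structured (X : {fset R * R}) (C : {fset nat})
    (phi : {fmap R * R -> nat}) : Prop :=
  [/\ exists x : R, {in X, forall I, x \in oitv I},
      #|` C| = omega X /\ {in C, forall c, (0 < c)%N},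
      [/\ domf phi = X, codomf phi `<=` C & proper_colouring phi],
      structured_along fst phi &
      structured_along snd phi].

(* The k smallest positive integers outside S; there are always at least k of
   them among 1, ..., k + #|S|. *)
Definition smallest_outside (k : nat) (S : {fset nat}) : {fset nat} :=
  [fset c in take k [seq c <- iota 1 (k + #|` S|) | c \notin S]].

Definition is_pillar (Is : {fset R * R}) (p : R) : Prop :=
  0 < p < 1 /\ {in Is, forall I, p \notin endpoints I}.

(* A triple (P, preceq, psi).  Only the values of pillar_le on pillars matter. *)
Record pillar_triple := PillarTriple {
  pillars : {fset R};
  pillar_le : rel R;
  colouring : {fmap R * R -> nat}
}.

Section Assignment.
Variables (Is : {fset R * R}) (A : pillar_triple).
Local Notation P := (pillars A).
Local Notation psi := (colouring A).

Definition pillar_lt (q p : R) : bool := (q != p) && pillar_le A q p.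

Definition total_order_on_pillars : Prop :=
  [/\ {in P, reflexive (pillar_le A)}, {in P &, antisymmetric (pillar_le A)},
      {in P & &, transitive (pillar_le A)} & {in P &, total (pillar_le A)}].

Definition assigned (p : R) : {fset R * R} :=
  [fset I in Is | (p \in oitv I) &&
                  all (fun q => pillar_lt q p ==> (q \notin oitv I)) P].

Definition is_foundation (p : R) (F : R * R) : Prop :=
  let E := [fset q in P | pillar_lt q p] in
  [/\ p \in oitv F, endpoints F `<=` E `|` [fset 0; 1] &
      {in E, forall q, q \notin oitv F}].

(* For p in P there is exactly one F with [is_foundation p F]; the default
   value (0, 1) is irrelevant. *)
Definition foundation (p : R) : R * R := xget (0, 1) [set F | is_foundation p F]%classic.

Definition foundation_cut (p : R) : {fset R * R} :=
  [fset I in Is | (I.1 \in oitv (foundation p)) (+)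
                  (I.2 \in oitv (foundation p))].

(* The sets [assigned p], p in P, are pairwise disjoint, so phi_p is the
   restriction of psi to [assigned p]. *)
Definition phi_of (p : R) : {fmap R * R -> nat} := psi.[& assigned p].

Definition psi_before (p : R) : {fmap R * R -> nat} :=
  psi.[& \bigcup_(q <- P | pillar_lt q p) assigned q].

Definition palette (p : R) : {fset nat} :=
  smallest_outside (omega (assigned p))
    (codomf (psi_before p).[& foundation_cut p]).

Definition pillar_assignment : Prop :=
  [/\ {in P, forall p, is_pillar Is p},
      total_order_on_pillars,
      domf psi = \bigcup_(p <- P) assigned p &
      {in P, forall p, structured (assigned p) (palette p) (phi_of p)}].

Definition complete : Prop :=
  {in Is, forall I, exists2 p, p \in P & p \in oitv I}.

Definition chi : nat := #|` codomf psi|.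

Definition is_arch (K : R * R) : Prop :=
  [/\ K.1 < K.2, endpoints K `<=` [fset 0; 1] `|` P &
      {in P, forall p, p \notin oitv K}].

Definition degree (J : R * R) : nat :=
  #|` codomf psi.[& [fset I in Is | (I.1 \in oitv J) || (I.2 \in oitv J)]]|.

End Assignment.

Definition extends (A' A : pillar_triple) : Prop :=
  [/\ pillars A `<=` pillars A',
      {in pillars A & pillars A' `\` pillars A, forall p q, pillar_lt A' p q},
      {in pillars A &, forall p q, pillar_le A' p q = pillar_le A p q} &
      forall I : domf (colouring A),
        (colouring A').[? val I] = Some (colouring A I)].

Definition log2 (x : R) : R := ln x / ln 2.

End Intervals.

(* Main.v *)
Require Import Defs.
From mathcomp Require Import all_boot all_order all_algebra finmap.
From mathcomp Require Import all_classical all_reals all_analysis.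
From mathcomp Require Import zify lra.

Set Implicit Arguments.
Unset Strict Implicit.
Unset Printing Implicit Defensive.

Import Order.TTheory GRing.Theory Num.Theory.

Local Open Scope fset_scope.
Local Open Scope fmap_scope.
Local Open Scope ring_scope.

(* Let L = log2 w, D = w (L + log2 L + 6) and T = D + w (L + log2 L + 4), and
   take an arch K that contains an interval without pillar.  With k levels of
   pillars, where k <= L + log2 L + 3 and 2^k > w (k + 3), cut K greedily into
   pieces of old degree S = D - k w and insert the cuts in the order of a
   balanced binary search tree.  Each piece then meets the new colours of at
   most k pillars, at most w for each, so its degree is at most D again, and the
   new colours are at most D + k w <= T.

   There are fewer than 2^k pieces by a Turan-type count.  A colour seen in K
   belongs to only one pillar, and that pillar lies on one side of K.  For each
   side, order the colours by their pillar and then by value: since colourings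
   are structured, a sequence of endpoints in K with increasing colours gives a
   clique of the same size.  Hence the pairs (piece, colour) seen from that side
   form a 0-1 matrix without strictly increasing chains of length w + 1, and so
   at most w (pieces + colours) pairs exist. *)

(** The obstacle is that a new pillar may bring [w] new colours into the whole arch that it cuts,
    while the degree of an arch controls the next palettes there; the slack [k w] between [S] and
    [D] pays for this in advance. New intervals avoid all old pillars, so they stay in the arch
    being cut and cost nothing elsewhere. The foundation of a new pillar lies in that arch too, so
    only colours seen there are forbidden and the palette ends at degree plus [w]. A colour in an
    arch has one pillar because an earlier interval ending there cuts the foundation of every later
    pillar that has an interval ending there. With [r] cut pieces of degree [S], the two sides give
    [r S <= 2 w r + w D], since their colours add up to the degree of [K]. Then [D >= (k + 3) w]
    yields [r <= w (k + 3)], and [2^k] leaves room for one more pillar, placed in the interval to be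
    hit. The 6 in [D] is this 3 plus the 3 in the bound on [k]. Palettes leave no holes, so the
    largest colour can be bounded instead of the number of colours. *)

(** * Heights in finite strict orders, and 0-1 matrices with bounded chains *)

Section Height.
Variables (T : finType) (r : rel T).
Hypotheses (r_irr : irreflexive r) (r_trans : transitive r).

(** Fuel [n] replaces well-founded recursion. With enough fuel the value is the size of a longest
    chain strictly below [x]. *)
Fixpoint height_rec (n : nat) (x : T) : nat :=
  if n is m.+1 then (\max_(y | r y x) (height_rec m y).+1)%N else 0%N.

Definition height : T -> nat := height_rec #|T|.

(** Passing to a predecessor strictly shrinks the set of elements below, so fuel exceeding the size
    of that set suffices. *)
Lemma height_rec_stable n x :
  (#|[pred y | r y x]| < n)%N -> height_rec n x = height_rec n.+1 x.
Proof.
elim: n x => [//|n IH] x lexn.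
rewrite /=; apply: eq_bigr => y ryx; congr _.+1; apply: IH.
rewrite -ltnS (leq_trans _ lexn)// ltnS proper_card//.
apply/properP; split; last by exists y; rewrite !inE ?r_irr.
by apply/fintype.subsetP => z; rewrite !inE => rzy; apply: r_trans ryx.
Qed.

Lemma heightE x : height x = (\max_(y | r y x) (height y).+1)%N.
Proof.
rewrite [LHS]height_rec_stable//.
apply: proper_card; apply/properP; split; first exact/fintype.subsetP.
by exists x; rewrite // !inE r_irr.
Qed.

Lemma height_lt x y : r x y -> (height x < height y)%N.
Proof.
move=> rxy; rewrite (heightE y).
exact: (@leq_bigmax_cond _ (r^~ y) (fun x => (height x).+1)).
Qed.

(** A predecessor realising the maximum in [heightE] is exactly one lower; descending along such
    predecessors skips no height. *)
Lemma height_witness y j : (j < height y)%N -> exists2 x, r x y & height x = j.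
Proof.
have [n] := ubnP (height y); elim: n y => // n IH y ltyn ltj.
have [x rxy yx] : exists2 x, r x y & height y = (height x).+1.
  have : (0 < #|[pred x | r x y]|)%N.
    rewrite lt0n; apply: contraL ltj => /eqP/card0_eq y0.
    by rewrite heightE big_pred0.
  by move=> /(eq_bigmax_cond (fun x => (height x).+1)) [x]; exists x;
    rewrite // heightE.
move: ltj; rewrite yx ltnS leq_eqVlt => /predU1P[->|ltj]; first by exists x.
have [|z rzx <-] := IH x _ ltj; first by lia.
by exists z => //; apply: r_trans rxy.
Qed.

(** Links heights to cliques: where chains are cliques, every height is below the clique number. *)
Lemma height_chain x : exists U : {set T},
  [/\ x \in U, #|U| = (height x).+1, {in U, forall y, (y == x) || r y x} &
      {in U &, forall y z, y != z -> r y z || r z y}].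
Proof.
have [n] := ubnP (height x); elim: n x => // n IH x ltxn.
have [x0|] := posnP (height x).
  exists [set x]; split; rewrite ?set11 ?cards1 ?x0// => y.
    by rewrite inE => ->.
  by move=> z /[!inE] /eqP-> /eqP->; rewrite eqxx.
move=> x0; have [|y ryx yE] := @height_witness x (height x).-1; first by lia.
have [|U [yU cU Uy Uc]] := IH y; first by lia.
have Ux z : z \in U -> r z x by move=> /Uy/predU1P[->//|rzy]; apply: r_trans ryx.
exists (x |: U); split.
- exact: setU11.
- rewrite cardsU1 cU yE; case: (boolP (x \in U)) => [/Ux|]; first by rewrite r_irr.
  by lia.
- by move=> z /setU1P[->|/Ux ->]; rewrite ?eqxx ?orbT.
- move=> z t /setU1P[->|zU] /setU1P[->|tU]; rewrite ?eqxx// => zt.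
  + by rewrite Ux ?orbT.
  + by rewrite Ux.
  + exact: Uc.
Qed.

End Height.

(* The points of an antichain for the strict product order have distinct
   differences a - b, so each of the at most w heights is taken at most m + n
   times. *)
Lemma card_bounded_chains (E : finType) (m n w : nat) (a : E -> 'I_m)
    (b : E -> 'I_n) :
  injective (fun x => (a x, b x)) ->
  (forall U : {set E},
     {in U &, forall x y, x != y -> ((a x < a y) && (b x < b y))%N ||
                                    ((a y < a x) && (b y < b x))%N} ->
     (#|U| <= w)%N) ->
  (#|E| <= w * (m + n))%N.
Proof.
move=> inj chainw; pose r x y := ((a x < a y) && (b x < b y))%N.
have rI : irreflexive r by move=> x; rewrite /r ltnn.
have rT : transitive r by move=> y x z; rewrite /r; lia.
have hw x : (height r x < w)%N.
  by have [U [_ <- _ Uc]] := height_chain rI rT x; apply: chainw.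
have dmn x : (a x + (n - b x) < m + n.+1)%N by move: (ltn_ord (a x)); lia.
(* This encodes [a x - b x], shifted by [n - 1] to stay a natural number; [b x < n] makes the
   predecessor exact. *)
have dmn' x : ((a x + (n - b x)).-1 < m + n)%N.
  by move: (ltn_ord (a x)) (ltn_ord (b x)); lia.
rewrite -(card_ord w) -(card_ord (m + n)) -card_prod.
pose f x := (Ordinal (hw x), Ordinal (dmn' x)).
apply: (@leq_card _ _ f) => x y [hxy dxy].
have nr u v : r u v -> height r u = height r v -> False.
  by move=> /(height_lt rI rT); lia.
have := @nr x y; have := @nr y x; rewrite hxy /r => nyx nxy.
apply: inj; congr pair; apply: val_inj => /=;
  move: (ltn_ord (b x)) (ltn_ord (b y)) => bx by';
  case: (ltngtP (a x) (a y)) => //= axy;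
  case: (ltngtP (b x) (b y)) => //= bxy; move: nxy nyx; rewrite ?axy ?bxy//=;
  move=> nxy nyx; try (by case: nxy); try (by case: nyx); lia.
Qed.

Lemma card_fset_image (T : finType) (K : choiceType) (f : T -> K) (U : {set T}) :
  injective f -> #|` [fset f x | x in U]| = #|U|.
Proof. by move=> fI; rewrite card_imfset// -[RHS]card_finset card_imfset. Qed.

(** * Chains in the dominance order of the plane, with either coordinate as [e] *)

Section DominanceHeight.
Variables (R : realType) (T : finType) (r : rel T) (e e' : T -> R).
Hypothesis rE : forall x y, r x y = (e x < e y) && (e' x < e' y).

Lemma dominance_irr : irreflexive r.
Proof. by move=> x; rewrite rE ltxx. Qed.

Lemma dominance_trans : transitive r.
Proof.
move=> y x z; rewrite !rE => /andP[xy xy'] /andP[yz yz'].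
by rewrite (lt_trans xy yz) (lt_trans xy' yz').
Qed.

Local Notation h := (height r).

(* Working from the last element down, x is kept when it is dominated by the
   next chosen y, and otherwise replaced by an element of the same height below
   y: it lies above x in the order of e because it cannot be dominated by x. *)
Lemma dominance_height_chain x s :
  path (fun x y => (h x < h y)%N && (e x < e y)) x s ->
  exists y t, [/\ path r y t, size t = size s, last y t = last x s,
                  h y = h x & e x <= e y].
Proof.
elim: s x => [|y s IH] x /=; first by exists x, [::].
move=> /andP[/andP[hxy exy] /IH[z [t [rzt szt lzt hz ez]]]].
have ltxz := lt_le_trans exy ez.
have [rxz|] := boolP (r x z).
  by exists x, (z :: t); split=> //=; rewrite ?rxz ?szt.
rewrite rE ltxz /= -leNgt => zx.
have [|u ruz hu] := @height_witness _ r dominance_irr dominance_trans z (h x).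
  by rewrite hz.
exists u, (z :: t); split=> //=; rewrite ?ruz ?szt//.
rewrite leNgt; apply/negP => ux.
suff /(height_lt dominance_irr dominance_trans) : r u x by rewrite hu ltnn.
by move: ruz; rewrite !rE ux => /andP[_ uz]; apply: lt_le_trans zx.
Qed.

(** The chain keeps the last member of the family, and its first member does not lie below [J ord0]
    along [e]; these facts give the two ends of the range. *)
Lemma dominance_height_family k (J : 'I_k.+1 -> T) :
  (forall i j : 'I_k.+1, (i < j)%N -> (h (J i) < h (J j))%N) ->
  (forall i j : 'I_k.+1, (i < j)%N -> e (J i) < e (J j)) ->
  exists Js : 'I_k.+1 -> T,
    (forall i j : 'I_k.+1, (i < j)%N -> r (Js i) (Js j)) /\
    (forall i, e (Js i) \in `[e (J ord0), e (J ord_max)]).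
Proof.
move=> hJ eJ.
pose s := mkseq (fun i => J (inord i.+1)) k.
have nthJ i : (i <= k)%N -> nth (J ord0) (J ord0 :: s) i = J (inord i).
  case: i => [_|i ik] /=; first by congr J; apply/val_inj; rewrite /= inordK.
  by rewrite nth_mkseq.
have [|y [t [ryt szt lyt _ ey]]] := @dominance_height_chain (J ord0) s.
  apply/(pathP (J ord0)) => i; rewrite size_mkseq => ik.
  by rewrite nthJ ?(ltnW ik)// nth_mkseq// hJ ?eJ ?inordK// ltnS// ltnW.
rewrite size_mkseq in szt.
have rlt i j : (i < j)%N -> (j < k.+1)%N -> r (nth y (y :: t) i) (nth y (y :: t) j).
  move=> ij jk; have /(sorted_ltn_nth dominance_trans y) : sorted r (y :: t) by [].
  by apply=> //; rewrite inE /= szt// (ltn_trans ij).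
exists (fun i => nth y (y :: t) i); split=> [i j ij|i]; first exact: rlt.
rewrite in_itv /=; apply/andP; split.
  have [->//|i0] := posnP i.
  by apply: (le_trans ey); have := rlt _ _ i0 (ltn_ord i); rewrite rE => /andP[/ltW].
have -> : J ord_max = nth y (y :: t) k.
  rewrite -{2}szt -last_nth lyt (last_nth (J ord0)) size_mkseq.
  by rewrite nthJ//; congr J; apply: val_inj; rewrite /= inordK.
have := ltn_ord i; rewrite ltnS leq_eqVlt => /predU1P[->//|ik].
by have := rlt _ _ ik (leqnn _); rewrite rE => /andP[/ltW].
Qed.

End DominanceHeight.

(** * Clique numbers of finite families of intervals *)

Section Omega.
Variable R : realType.
Implicit Types (X Y : {fset R * R}) (I J : R * R).

Lemma omega_ge X Y : Y `<=` X -> pairwise_overlapping Y -> (#|` Y| <= omega X)%N.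
Proof.
move=> YX cY; rewrite /omega.
by apply: (@leq_bigmax_seq _ (enum_fset (fpowerset X))
  (fun Z => `[< pairwise_overlapping Z >]) (fun Z => #|` Z|));
  [rewrite fpowersetE|apply/asboolP].
Qed.

Lemma omega_le X n :
  (forall Y, Y `<=` X -> pairwise_overlapping Y -> (#|` Y| <= n)%N) ->
  (omega X <= n)%N.
Proof.
move=> Xn; apply/bigmax_leqP_seq => Y; rewrite fpowersetE => YX /asboolP.
exact: Xn.
Qed.

Lemma omega_attained X :
  exists Y, [/\ Y `<=` X, pairwise_overlapping Y & #|` Y| = omega X].
Proof.
apply: contrapT => nY.
have ltX Y : Y `<=` X -> pairwise_overlapping Y -> (#|` Y| < omega X)%N.
  move=> YX cY; rewrite ltn_neqAle omega_ge// andbT; apply/eqP => Yo.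
  by apply: nY; exists Y.
have c0 : pairwise_overlapping (fset0 : {fset R * R}) by move=> I J; rewrite inE.
have o0 := ltX fset0 (fsub0set _) c0; have : (omega X <= (omega X).-1)%N.
  by apply: omega_le => Y YX cY; have := ltX Y YX cY; lia.
by lia.
Qed.

Lemma omega_mono X Y : X `<=` Y -> (omega X <= omega Y)%N.
Proof.
by move=> XY; apply: omega_le => Z ZX; apply: omega_ge; apply: fsubset_trans XY.
Qed.

End Omega.

(** * Overlap in coordinates, and existence of structured colourings *)

Section IntervalSystem.
Variables (R : realType) (Is : {fset R * R}).
Hypothesis sysIs : interval_system Is.
Implicit Types (I J : R * R).

Lemma interval_lt I : I \in Is -> I.1 < I.2.
Proof. by move=> /sysIs.1/and3P[]. Qed.

Lemma endpoint_inj I J x : I \in Is -> J \in Is ->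
  x \in endpoints I -> x \in endpoints J -> I = J.
Proof.
move=> II JI xI xJ; apply/eqP; apply: contraT => /(sysIs.2 _ _ II JI).
by move=> /fdisjointP/(_ _ xI); rewrite xJ.
Qed.

Lemma overlapP I J : I \in Is -> J \in Is ->
  overlap I J <-> [&& I.1 < J.1, J.1 < I.2 & I.2 < J.2] \/
                  [&& J.1 < I.1, I.1 < J.2 & J.2 < I.2].
Proof.
move=> II JI; have lI := interval_lt II; have lJ := interval_lt JI.
have mid (a b : R) : a < b -> exists2 x, a < x & x < b.
  by move=> ab; exists ((a + b) / 2); lra.
have crossing (I' J' : R * R) : I'.1 < J'.1 -> J'.1 < I'.2 -> I'.2 < J'.2 -> overlap I' J'.
  move=> a b c; split.
  - by apply: contraTneq a => ->; rewrite ltxx.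
  - by have [x x1 x2] := mid _ _ b; exists x; split; rewrite /= in_itv /=; lra.
  - have [x x1 x2] := mid _ _ a => /(_ x); rewrite /= !in_itv /= => H.
    have /andP[] : J'.1 < x < J'.2 by apply: H; lra.
    by lra.
  - have [x x1 x2] := mid _ _ c => /(_ x); rewrite /= !in_itv /= => H.
    have /andP[] : I'.1 < x < I'.2 by apply: H; lra.
    by lra.
split; last by case=> /and3P[] *; [|apply: overlap_sym]; apply: crossing.
move=> [IJ [x []]] /=; rewrite !in_itv /= => /andP[x1 x2] /andP[x3 x4] nIJ nJI.
have nsub (I' J' : R * R) : ~ ([set` oitv I'] `<=` [set` oitv J'])%classic ->
    ~ (J'.1 <= I'.1 /\ I'.2 <= J'.2).
  move=> nsub [l1 l2]; apply: nsub => y /=; rewrite !in_itv /=; lra.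
move: (nsub _ _ nIJ) (nsub _ _ nJI) => nIJ' nJI'.
have [l|l|eq1] := ltgtP I.1 J.1.
- left; apply/and3P; split=> //; first by lra.
  by rewrite ltNge; apply/negP => l2; apply: nJI'; split=> //; apply: ltW.
- right; apply/and3P; split=> //; first by lra.
  by rewrite ltNge; apply/negP => l2; apply: nIJ'; split=> //; apply: ltW.
- by case/eqP: IJ; apply: (@endpoint_inj I J I.1) => //; rewrite !inE ?eq1 eqxx.
Qed.

Definition dominated : rel (R * R) := fun I J => (I.1 < J.1) && (I.2 < J.2).

(** Intervals through a common point already meet, so overlapping becomes comparability in the
    dominance order and cliques become chains. *)
Lemma overlap_common x I J : I \in Is -> J \in Is -> x \in oitv I -> x \in oitv J ->
  overlap I J <-> dominated I J || dominated J I.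
Proof.
move=> II JI; rewrite !in_itv /= => /andP[x1 x2] /andP[x3 x4].
rewrite overlapP// /dominated; split.
  by case=> /and3P[-> _ ->]; rewrite ?orbT.
by case/orP=> /andP[-> ->]; [left|right]; rewrite andbT /=; lra.
Qed.

(** Each interval gets the colour of [C] whose position, counted from 0, is its height in the
    dominance order. Heights stay below [omega X] because chains are cliques, and increasing colours
    mean increasing heights, so [dominance_height_family] gives both structure conditions, with the
    coordinates exchanged for the second. *)
Lemma structured_colouring_exists (X : {fset R * R}) (C : {fset nat}) x :
  X `<=` Is -> {in X, forall I, x \in oitv I} ->
  #|` C| = omega X -> {in C, forall c, (0 < c)%N} ->
  exists phi, structured X C phi.
Proof.
move=> /fsubsetP XI Xx cC C0.
pose r : rel X := fun (I J : X) => dominated (val I) (val J).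
have rE1 (I J : X) : r I J = ((val I).1 < (val J).1) && ((val I).2 < (val J).2) by [].
have rE2 (I J : X) : r I J = ((val I).2 < (val J).2) && ((val I).1 < (val J).1).
  by rewrite rE1 andbC.
have rI := dominance_irr rE1; have rT := dominance_trans rE1.
have ovE (I J : X) : overlap (val I) (val J) <-> r I J || r J I.
  by apply: overlap_common (Xx _ (valP I)) (Xx _ (valP J)); apply/XI/valP.
have hX (I : X) : (height r I < omega X)%N.
  have [U [_ <- _ Uc]] := height_chain rI rT I.
  rewrite -(card_fset_image U val_inj); apply: omega_ge.
    by apply/fsubsetP => _ /imfsetP[J _ ->]; apply: valP.
  move=> _ _ /imfsetP[I1 I1U ->] /imfsetP[I2 I2U ->] I12.
  by apply/ovE; apply: Uc.
pose s := sort leq C.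
have szs : size s = omega X by rewrite size_sort cC.
have sC c : (c \in s) = (c \in C) by rewrite mem_sort.
have ss : sorted ltn s.
  by rewrite ltn_sorted_uniq_leq sort_uniq fset_uniq sort_sorted//; apply: leq_total.
have s_lt i j : (i < j)%N -> (j < omega X)%N -> (nth 0%N s i < nth 0%N s j)%N.
  move=> ij jo; apply: (sorted_ltn_nth ltn_trans 0%N ss) => //.
    by rewrite inE szs (ltn_trans ij).
  by rewrite inE szs.
have lt_s i j : (i < omega X)%N -> (nth 0%N s i < nth 0%N s j)%N -> (i < j)%N.
  move=> io; rewrite ltnNge => ij; rewrite ltnNge; apply: contra ij.
  by rewrite leq_eqVlt => /predU1P[->//|/s_lt/(_ io)/ltnW].
pose phi := [fmap I : X => nth 0%N s (height r I)].
exists phi; split.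
- by exists x.
- by [].
- split=> //.
    apply/fsubsetP => c /codomfP[I]; case: fndP => // IX [<-].
    by rewrite ffunE -sC mem_nth// szs hX.
  move=> I J /ovE/orP[] /(height_lt rI rT) hIJ;
    by rewrite !ffunE neq_ltn (s_lt _ _ hIJ (hX _)) ?orbT.
- move=> k J phiJ eJ.
  have [|Js [Jr Je]] := @dominance_height_family _ _ r _ _ rE1 k J _ eJ.
    by move=> i j /phiJ; rewrite !ffunE; apply: lt_s; apply: hX.
  exists Js; split=> // i j; rewrite neq_ltn => /orP[] ij.
    by apply: (ovE (Js i) (Js j)).2; rewrite (Jr _ _ ij).
  by apply: (ovE (Js i) (Js j)).2; rewrite (Jr _ _ ij) orbT.
- move=> k J phiJ eJ.
  have [|Js [Jr Je]] := @dominance_height_family _ _ r _ _ rE2 k J _ eJ.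
    by move=> i j /phiJ; rewrite !ffunE; apply: lt_s; apply: hX.
  exists Js; split=> // i j; rewrite neq_ltn => /orP[] ij.
    by apply: (ovE (Js i) (Js j)).2; rewrite (Jr _ _ ij).
  by apply: (ovE (Js i) (Js j)).2; rewrite (Jr _ _ ij) orbT.
Qed.

End IntervalSystem.

(** * Palettes of smallest free colours *)

Section SmallestOutside.
Implicit Types (S : {fset nat}) (k c : nat).

Local Notation candidates k S := [seq c <- iota 1 (k + #|` S|) | c \notin S].

Lemma size_candidates k S : (k <= size (candidates k S))%N.
Proof.
have := count_predC (fun c => c \in S) (iota 1 (k + #|` S|)).
rewrite size_iota -(size_filter (predC (fun c => c \in S))) => cE.
suff : (count (fun c => c \in S) (iota 1 (k + #|` S|)) <= #|` S|)%N.
  by move: cE; rewrite [X in (_ + X)%N](_ : _ = size (candidates k S))//; lia.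
rewrite -size_filter uniq_leq_size ?filter_uniq ?iota_uniq// => c.
by rewrite mem_filter => /andP[].
Qed.

Lemma sorted_candidates k S : sorted ltn (candidates k S).
Proof. by rewrite sorted_filter ?iota_ltn_sorted//; apply: ltn_trans. Qed.

Lemma in_smallest_outside k S c :
  (c \in smallest_outside k S) = (c \in take k (candidates k S)).
Proof. by rewrite /smallest_outside inE. Qed.

Lemma smallest_outsideP k S c : c \in smallest_outside k S ->
  [/\ (0 < c)%N, (c <= k + #|` S|)%N & c \notin S].
Proof.
rewrite in_smallest_outside => /mem_take; rewrite mem_filter mem_iota.
by case/and3P=> -> -> ; split=> //; lia.
Qed.

Lemma card_smallest_outside k S : #|` smallest_outside k S| = k.
Proof.
rewrite /smallest_outside card_fseq undup_id.
  by rewrite size_takel// size_candidates.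
by rewrite take_uniq// filter_uniq// iota_uniq.
Qed.

(** Candidates are listed in increasing order, so none smaller than a chosen one is left behind.
    This is what makes the used colours an initial segment. *)
Lemma smallest_outside_initial k S c d : c \in smallest_outside k S ->
  (0 < d <= c)%N -> (d \in S) || (d \in smallest_outside k S).
Proof.
move=> cS /andP[d0 dc]; have [_ ck _] := smallest_outsideP cS.
apply/norP => -[dS]; apply/negP; rewrite negbK.
move: cS; rewrite !in_smallest_outside; set s := candidates k S => cS.
have ds : d \in s by rewrite mem_filter dS mem_iota; lia.
have ss : sorted ltn s := sorted_candidates k S.
move: ds; rewrite -{1}(cat_take_drop k s) mem_cat => /orP[//|dd].
have : sorted ltn (take k s ++ drop k s) by rewrite cat_take_drop.
rewrite (sorted_pairwise ltn_trans) pairwise_cat => /and3P[/allrelP/(_ _ _ cS dd)].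
by rewrite /ltn /=; lia.
Qed.

End SmallestOutside.

(** * Gaps between finitely many points *)

Section FiniteSets.
Variable R : realType.
Implicit Types (S Q V : {fset R}) (F J K : R * R).

Lemma fset_max S x : x \in S -> exists2 y, y \in S & {in S, forall z, z <= y}.
Proof.
move=> xS; case: (@arg_maxP _ _ _ [` xS] xpredT (fun u : S => val u)) => // u _ um.
by exists (val u) => [|z zS]; [exact: valP|exact: (um [` zS])].
Qed.

Lemma fset_min S x : x \in S -> exists2 y, y \in S & {in S, forall z, y <= z}.
Proof.
move=> xS; case: (@arg_minP _ _ _ [` xS] xpredT (fun u : S => val u)) => // u _ um.
by exists (val u) => [|z zS]; [exact: valP|exact: (um [` zS])].
Qed.

(** The ends are the nearest points of [Q], or 0 and 1, on either side of [x]. This produces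
    foundations as well as arches. *)
Lemma gap_exists Q x : 0 < x < 1 -> x \notin Q ->
  exists F, [/\ x \in oitv F, endpoints F `<=` Q `|` [fset 0; 1],
                {in Q, forall q, q \notin oitv F}, 0 <= F.1 & F.2 <= 1].
Proof.
move=> /andP[x0 x1] xQ.
have [|a] := @fset_max (0 |` [fset q in Q | q < x]) 0; first by rewrite !inE eqxx.
rewrite !inE => aQ amax.
have [|b] := @fset_min (1 |` [fset q in Q | x < q]) 1; first by rewrite !inE eqxx.
rewrite !inE => bQ bmin.
have ax : a < x by case/orP: aQ => [/eqP->//|/andP[]].
have xb : x < b by case/orP: bQ => [/eqP->//|/andP[]].
exists (a, b); split=> /=.
- by rewrite in_itv /= ax.
- apply/fsubsetP => y; rewrite !inE => /orP[]/eqP->.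
    by case/orP: aQ => [->|/andP[->]]; rewrite ?orbT.
  by case/orP: bQ => [->|/andP[->]]; rewrite ?orbT.
- move=> q qQ; rewrite in_itv /=; apply/negP => /andP[aq qb].
  have [qx|xq|qx] := ltgtP q x; last by rewrite qx (negPf xQ) in qQ.
    by have := amax q; rewrite !inE qQ qx orbT leNgt aq => /(_ isT).
  by have := bmin q; rewrite !inE qQ xq orbT leNgt qb => /(_ isT).
- by apply: amax; rewrite !inE eqxx.
- by apply: bmin; rewrite !inE eqxx.
Qed.

(** No end of [K] lies inside [J], because it is 0, 1 or a point of [Q]; so a [J] that reaches into
    [K] cannot leave it. *)
Lemma gap_maximal Q K J : endpoints K `<=` Q `|` [fset 0; 1] ->
  0 <= J.1 -> J.2 <= 1 -> {in Q, forall q, q \notin oitv J} ->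
  K.1 < J.2 -> J.1 < K.2 -> K.1 <= J.1 /\ J.2 <= K.2.
Proof.
move=> /fsubsetP eK J0 J1 nJ KJ JK.
have eKP z : z \in endpoints K -> (z <= J.1 \/ J.2 <= z) \/ z = 0 \/ z = 1.
  move=> /eK; rewrite in_fsetU in_fset2 => /or3P[/nJ|/eqP|/eqP].
  - by rewrite in_itv /= negb_and -!leNgt => /orP; left.
  - by right; left.
  - by right; right.
split.
  by have [|[]|[]] := eKP K.1; [rewrite in_fset2 eqxx|lra..].
by have [|[]|[]] := eKP K.2; [rewrite in_fset2 eqxx orbT|lra..].
Qed.

Lemma avoid_finite V (a b : R) : a < b -> exists2 x, a < x < b & x \notin V.
Proof.
move=> ab; have [|c] := @fset_min (b |` [fset v in V | a < v]) b.
  by rewrite !inE eqxx.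
rewrite !inE => cV cmin.
have ac : a < c by case/orP: cV => [/eqP->//|/andP[]].
have cb : c <= b by apply: cmin; rewrite !inE eqxx.
exists ((a + c) / 2); first by lra.
apply/negP => mV; have := cmin ((a + c) / 2); rewrite !inE mV /=.
have -> : a < (a + c) / 2 by lra.
by rewrite orbT => /(_ isT); lra.
Qed.

End FiniteSets.

(** * Cliques from structured colourings, for sets instead of indexed families *)

Section StructuredMap.
Variables (R : realType) (e : R * R -> R) (phi : {fmap R * R -> nat}).
Hypothesis structured_phi : structured_along e phi.

(** The set is sorted by [e] to form an indexed family. The bounds on [e (g I)] by values taken on
    [U] later keep the clique inside the arch and in order with the cliques of other pillars. The
    default 0 is not reached, as [U] lies in [domf phi]. *)
Lemma structured_along_map (U : {fset R * R}) :
  U `<=` domf phi -> {in U &, injective e} ->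
  {in U &, forall I J, e I < e J ->
     (odflt 0%N phi.[? I] < odflt 0%N phi.[? J])%N} ->
  exists g : R * R -> R * R,
    {in U, forall I, g I \in domf phi /\
       exists I1 I2, [/\ I1 \in U, I2 \in U & e I1 <= e (g I) <= e I2]} /\
    {in U &, forall I J, I != J -> overlap (g I) (g J)}.
Proof.
move=> /fsubsetP Uphi eU cU.
have [->|[I0 I0U]] := fset_0Vmem U.
  by exists id; split=> [I|I J]; rewrite inE.
pose s := sort (fun I J => e I <= e J) U.
have sU I : (I \in s) = (I \in U) by rewrite mem_sort.
have [k sk] : exists k, size s = k.+1.
  by exists (size s).-1; rewrite prednK// lt0n size_eq0; apply: contraTneq I0U;
    rewrite -sU => ->.
have s_lt i j : (i < j)%N -> (j < k.+1)%N -> e (nth I0 s i) < e (nth I0 s j).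
  move=> ij jk; have ik := ltn_trans ij jk.
  have nU l : (l < k.+1)%N -> nth I0 s l \in U by move=> lk; rewrite -sU mem_nth ?sk.
  rewrite lt_neqAle; apply/andP; split.
    apply: contraTneq (ij) => /(eU _ _ (nU _ ik) (nU _ jk))/eqP.
    by rewrite nth_uniq ?sk ?sort_uniq ?fset_uniq// => /eqP->; rewrite ltnn.
  have sorted_s : sorted (fun I J => e I <= e J) s.
    by apply: sort_sorted => I J; apply: le_total.
  apply: (sorted_ltn_nth _ I0 sorted_s); rewrite ?inE ?sk//.
  by move=> I J K; apply: le_trans.
have sphi (i : 'I_k.+1) : nth I0 s i \in domf phi.
  by apply: Uphi; rewrite -sU mem_nth ?sk.
have [||Js [ovJ eJ]] := @structured_phi k (fun i => [` sphi i]).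
- move=> i j ij; have := s_lt _ _ ij (ltn_ord j).
  have nU (l : 'I_k.+1) : nth I0 s l \in U by rewrite -sU mem_nth ?sk.
  by move=> /cU; rewrite !in_fnd; apply.
- by move=> i j ij; apply: s_lt.
have idx I : I \in U -> (index I s < k.+1)%N by rewrite -sk index_mem sU.
exists (fun I => val (Js (inord (index I s)))); split=> [I IU|I J IU JU IJ].
  split; first exact: valP.
  exists (nth I0 s 0), (nth I0 s k); split; rewrite -?sU ?mem_nth ?sk//.
  by have := eJ (inord (index I s)); rewrite in_itv.
apply: ovJ; apply: contra IJ => /eqP/(congr1 val); rewrite /= !inordK ?idx// => ij.
by rewrite -(nth_index I0 (_ : I \in s)) ?sU// ij nth_index ?sU.
Qed.

End StructuredMap.

(** * Pillars and colours of the intervals ending in an arch *)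

Section Assignment.
Variables (R : realType) (Is : {fset R * R}) (A : pillar_triple R).
Hypotheses (sysIs : interval_system Is) (pA : pillar_assignment Is A).
Local Notation P := (pillars A).
Local Notation psi := (colouring A).
Implicit Types (I J K : R * R) (p q : R).

Lemma assignedP p I : reflect
  [/\ I \in Is, p \in oitv I & {in P, forall q, pillar_lt A q p -> q \notin oitv I}]
  (I \in assigned Is A p).
Proof.
rewrite !inE; apply: (iffP and3P) => -[II pI].
  by move=> /allP nI; split=> // q /nI/implyP.
by move=> nI; split=> //; apply/allP => q qP; apply/implyP/nI.
Qed.

Lemma codomf_restrictP (f : {fmap R * R -> nat}) (D : {fset R * R}) c : reflect
  (exists2 I, I \in D & f.[? I] = Some c) (c \in codomf f.[& D]).
Proof.
apply: (iffP (codomfP _ _)) => [[I]|[I ID fI]].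
  by rewrite fnd_restrict; case: ifP => // ID fI; exists I.
by exists I; rewrite fnd_restrict ID.
Qed.

Lemma pillar01 p : p \in P -> 0 < p < 1.
Proof. by case: pA => + _ _ _ => /[apply] -[]. Qed.

Lemma pillar_lt_total p q : p \in P -> q \in P -> p != q ->
  pillar_lt A p q || pillar_lt A q p.
Proof.
case: pA => _ [_ _ _ tot] _ _ pP qP pq.
by rewrite /pillar_lt pq eq_sym pq /=; exact: tot.
Qed.

Lemma assigned_inj p q I : p \in P -> q \in P ->
  I \in assigned Is A p -> I \in assigned Is A q -> p = q.
Proof.
move=> pP qP /assignedP[_ pI nI] /assignedP[_ qI nI'].
apply/eqP; apply: contraT => /(pillar_lt_total pP qP)/orP[lpq|lqp].
  by have := nI' p pP lpq; rewrite pI.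
by have := nI q qP lqp; rewrite qI.
Qed.

Lemma coloured_assigned I c : psi.[? I] = Some c ->
  exists p, [/\ p \in P, I \in assigned Is A p & c \in palette Is A p].
Proof.
case: pA => _ _ dom st psiI.
have : I \in domf psi by rewrite -fndSome psiI.
rewrite dom => /bigfcupP[p /andP[pP _] Ip]; exists p; split=> //.
have [_ _ [_ /fsubsetP + _] _ _] := st p pP; apply.
by apply/codomf_restrictP; exists I.
Qed.

Lemma assigned_coloured p I : p \in P -> I \in assigned Is A p ->
  exists c, psi.[? I] = Some c.
Proof.
case: pA => _ _ dom _ pP Ip; suff : I \in domf psi.
  by case: fndP => // Ipsi _; eexists.
by rewrite dom; apply/bigfcupP; exists p; rewrite ?pP.
Qed.

Lemma foundationP p : p \in P -> is_foundation A p (foundation A p).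
Proof.
move=> pP; rewrite /foundation; apply: xgetPex.
have [|F [pF eF nF _ _]] :=
    @gap_exists R [fset q in P | pillar_lt A q p] p (pillar01 pP).
  by rewrite !inE /pillar_lt eqxx andbF.
by exists F.
Qed.

Lemma is_arch_bounds K : is_arch A K -> 0 <= K.1 /\ K.2 <= 1.
Proof.
move=> [lK /fsubsetP eK _].
have : K.1 \in [fset 0; 1] `|` P by apply: eK; rewrite !inE eqxx.
have : K.2 \in [fset 0; 1] `|` P by apply: eK; rewrite !inE eqxx orbT.
by rewrite !inE => /orP[/orP[]/eqP->|/pillar01/andP[l2 u2]]
  /orP[/orP[]/eqP->|/pillar01/andP[l1 u1]]; lra.
Qed.

(** The ends of the foundation lie neither inside [J], which avoids earlier pillars, nor inside [K],
    which avoids all pillars. As [J] leads from [p] to the point [x] of [K], no end separates [K]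
    from [p], and the foundation contains all of [K]. *)
Lemma arch_sub_foundation K p J x y : is_arch A K -> p \in P ->
  J \in assigned Is A p -> x \in endpoints J -> x \in oitv K -> y \in oitv K ->
  y \in oitv (foundation A p).
Proof.
move=> aK pP /assignedP[JI pJ nJ] xJ xK yK.
have [K0 K1] := is_arch_bounds aK; have [_ _ nK] := aK.
have [pF /fsubsetP eF _] := foundationP pP; set F := foundation A p in pF eF *.
have [p0 p1] := andP (pillar01 pP).
move: xK yK pF pJ; rewrite !in_itv /= => /andP[x1 x2] /andP[y1 y2] /andP[F1 F2].
move=> /andP[J1 J2].
have Fz z : z \in endpoints F -> (z <= K.1 \/ K.2 <= z) /\
    [\/ z <= 0, 1 <= z, z <= J.1 | J.2 <= z].
  have notin_oitv (I : R * R) : z \notin oitv I -> z <= I.1 \/ I.2 <= z.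
    by rewrite in_itv /= negb_and -!leNgt => /orP.
  move=> /eF; rewrite !inE => /orP[/andP[zP lzp]|].
    split; first exact: notin_oitv (nK z zP).
    by case: (notin_oitv J (nJ z zP lzp)) => ?; [apply: Or43|apply: Or44].
  move=> /orP[]/eqP->; split; try by [apply: Or41|apply: Or42].
    by left.
  by right.
have [|aK1 aJ1] := Fz F.1; first by rewrite !inE eqxx.
have [|aK2 aJ2] := Fz F.2; first by rewrite !inE eqxx orbT.
have xE : x = J.1 \/ x = J.2 by move: xJ; rewrite !inE => /orP[]/eqP; [left|right].
apply/andP; split.
  by case: xE => xE; case: aK1 => aK1; case: aJ1 => aJ1; lra.
by case: xE => xE; case: aK2 => aK2; case: aJ2 => aJ2; lra.
Qed.

(** [I] has an end in [K], hence in the foundation of [q], and contains [p], which lies outside that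
    foundation. So [I] cuts it, and the colour of [I] is excluded from the palette of [q]. *)
Lemma earlier_colour_neq K p q I J x y : is_arch A K -> p \in P -> q \in P ->
  I \in assigned Is A p -> J \in assigned Is A q ->
  x \in endpoints I -> y \in endpoints J -> x \in oitv K -> y \in oitv K ->
  pillar_lt A p q -> psi.[? I] <> psi.[? J].
Proof.
move=> aK pP qP Ip Jq xI yJ xK yK lpq eqc.
have [c psiI] := assigned_coloured pP Ip.
have psiJ : psi.[? J] = Some c by rewrite -eqc.
have [q' [q'P Jq' /smallest_outsideP[_ _ /negP]]] := coloured_assigned psiJ.
rewrite (assigned_inj q'P qP Jq' Jq); apply.
have [II pI nI] := assignedP _ _ Ip.
apply/codomf_restrictP; exists I; last first.
  rewrite fnd_restrict psiI; case: ifP => // /negP[].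
  by apply/bigfcupP; exists p; rewrite ?pP.
have xF := arch_sub_foundation aK qP Jq yJ yK xK.
have pF : p \notin oitv (foundation A q).
  by have [_ _ ] := foundationP qP; apply; rewrite !inE pP.
suff : (I.1 \in oitv (foundation A q)) (+) (I.2 \in oitv (foundation A q)).
  by rewrite !inE II.
move: xI pI xF pF; rewrite in_fset2 !in_itv /=.
set F := foundation A q => /orP[]/eqP-> /andP[I1 I2] xF nF.
  rewrite xF /=; apply: contra nF => /andP[_ F2]; case/andP: xF => F1 _.
  by rewrite (lt_trans F1 I1) (lt_trans I2 F2).
rewrite xF addbT; apply: contra nF => /andP[F1 _]; case/andP: xF => _ F2.
by rewrite (lt_trans F1 I1) (lt_trans I2 F2).
Qed.

Lemma same_colour_same_pillar K p q I J x y : is_arch A K -> p \in P -> q \in P ->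
  I \in assigned Is A p -> J \in assigned Is A q ->
  x \in endpoints I -> y \in endpoints J -> x \in oitv K -> y \in oitv K ->
  psi.[? I] = psi.[? J] -> p = q.
Proof.
move=> aK pP qP Ip Jq xI yJ xK yK eqc.
apply/eqP; apply: contraT => /(pillar_lt_total pP qP)/orP[lpq|lqp].
  by have := earlier_colour_neq aK pP qP Ip Jq xI yJ xK yK lpq.
by have := earlier_colour_neq aK qP pP Jq Ip yJ xI yK xK lqp; rewrite eqc.
Qed.

Definition pillar_of I : R := xget 0 [set p | p \in P /\ I \in assigned Is A p]%classic.

Definition colour_of I : nat := odflt 0%N psi.[? I].

Lemma pillar_ofE p I : p \in P -> I \in assigned Is A p -> pillar_of I = p.
Proof.
move=> pP Ip; apply: xget_unique => // q [qP Iq].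
exact: assigned_inj Iq Ip.
Qed.

Section OneSide.
Variable e : R * R -> R.
Hypothesis e_side : e = fst \/ e = snd.

Lemma side_endpoint I : e I \in endpoints I.
Proof. by case: e_side => ->; rewrite !inE eqxx ?orbT. Qed.

(** With left ends in [K], both pillars lie to the right and [J] contains both. As [J] is assigned
    to [q], the pillar [q] is the earlier one; so [I] misses [q] and ends before [J] does. For right
    ends the picture is mirrored: [I] contains both pillars and [p] is the earlier one. *)
Lemma cross_overlap K p q I J : is_arch A K -> p \in P -> q \in P ->
  I \in assigned Is A p -> J \in assigned Is A q ->
  e I \in oitv K -> e J \in oitv K -> p < q -> e I < e J -> overlap I J.
Proof.
move=> [_ _ nK] pP qP /assignedP[II pI nI] /assignedP[JI qJ nJ].
have := nK p pP; have := nK q qP; move: (nI q qP) (nJ p pP) pI qJ.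
rewrite !in_itv /= => {}nI {}nJ /andP[I1 I2] /andP[J1 J2].
rewrite !negb_and -!leNgt => qK pK eI eJ pq eIJ.
have := pillar_lt_total pP qP; rewrite lt_eqF// => /(_ isT)/orP lpq.
apply/(overlapP sysIs II JI); left.
case: e_side => eE; rewrite eE in eI eJ eIJ; move: eI eJ => /andP[e1 e2] /andP[e3 e4].
  have pJ : J.1 < p < J.2 by case/orP: pK; lra.
  case: lpq => [/nJ|/nI]; first by rewrite pJ.
  by rewrite negb_and -!leNgt => /orP[]; case/andP: pJ; lra.
have qI : I.1 < q < I.2 by case/orP: qK; lra.
case: lpq => [/nJ|/nI]; last by rewrite qI.
by rewrite negb_and -!leNgt => /orP[]; case/andP: qI; lra.
Qed.

Lemma structured_side p : p \in P -> structured_along e (phi_of Is A p).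
Proof. by case: pA => _ _ _ + pP => /(_ p pP)[_ _ _]; case: e_side => ->. Qed.

(* Within one pillar, a structured colouring turns the sequence into a clique
   spanning the same endpoints; across pillars the overlaps are automatic. *)
Lemma card_side_chain K (U : {fset R * R}) : is_arch A K ->
  {in U, forall I, (exists2 p, p \in P & I \in assigned Is A p) /\ e I \in oitv K} ->
  {in U &, forall I J, e I < e J ->
     pillar_of I < pillar_of J \/
     pillar_of I = pillar_of J /\ (colour_of I < colour_of J)%N} ->
  (#|` U| <= omega Is)%N.
Proof.
move=> aK Uas Uinc.
have UI I : I \in U -> I \in Is by move=> /Uas[[p _ /assignedP[]]].
have e_inj : {in U &, injective e}.
  move=> I J IU JU eIJ; apply: (endpoint_inj sysIs (UI _ IU) (UI _ JU)).
    exact: side_endpoint.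
  by rewrite eIJ; apply: side_endpoint.
have Upil I : I \in U -> pillar_of I \in P /\ I \in assigned Is A (pillar_of I).
  by move=> /Uas[[p pP Ip] _]; rewrite (pillar_ofE pP Ip).
pose Up p := [fset I in U | pillar_of I == p].
have in_Up p I : (I \in Up p) = (I \in U) && (pillar_of I == p) by rewrite !inE.
have /choice[g gP] : forall p, exists g : R * R -> R * R,
    {in Up p, forall I, g I \in assigned Is A p /\
       exists I1 I2, [/\ I1 \in Up p, I2 \in Up p & e I1 <= e (g I) <= e I2]} /\
    {in Up p &, forall I J, I != J -> overlap (g I) (g J)}.
  (* The choice ranges over all reals; for [p] outside [P] the set [Up p] is empty and any map will
     do. *)
  move=> p; have [pP|pP] := boolP (p \in P); last first.
    by exists id; split=> I => [|J]; rewrite in_Up => /andP[/Upil[IP _] /eqP Ip];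
      rewrite Ip (negPf pP) in IP.
  have domp : domf (phi_of Is A p) = assigned Is A p.
    by case: pA => _ _ _ /(_ p pP)[_ _ []].
  rewrite -domp; apply: structured_along_map; first exact: structured_side.
  - rewrite domp; apply/fsubsetP => I; rewrite in_Up => /andP[/Upil[_ +] /eqP <-].
    by [].
  - by move=> I J; rewrite !in_Up => /andP[IU _] /andP[JU _]; apply: e_inj.
  - move=> I J; rewrite !in_Up => /andP[IU /eqP Ip] /andP[JU /eqP Jp] /Uinc.
    move=> /(_ IU JU); rewrite Ip Jp ltxx => -[//|[_]].
    rewrite /colour_of !fnd_restrict.
    by have [_] := Upil _ IU; have [_] := Upil _ JU; rewrite Ip Jp => -> ->.
pose G I := g (pillar_of I) I.
have UUp I : I \in U -> I \in Up (pillar_of I) by move=> IU; rewrite in_Up IU eqxx.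
have GK I : I \in U -> [/\ G I \in assigned Is A (pillar_of I), e (G I) \in oitv K &
    exists I1 I2, [/\ I1 \in Up (pillar_of I), I2 \in Up (pillar_of I) &
      e I1 <= e (G I) <= e I2]].
  move=> IU; have [/(_ I (UUp I IU))[Gas [I1 [I2 [I1U I2U Ge]]]] _] := gP (pillar_of I).
  split=> //; last by exists I1, I2.
  move: I1U I2U; rewrite !in_Up => /andP[/Uas[_ I1K] _] /andP[/Uas[_ I2K] _].
  move: I1K I2K Ge; rewrite !in_itv /= /G; lra.
have G_lt I J : I \in U -> J \in U -> pillar_of I < pillar_of J -> overlap (G I) (G J).
  move=> IU JU ltIJ; have [GI GIK [_ [I2 [_ I2U /andP[_ Ge]]]]] := GK I IU.
  have [GJ GJK [J1 [_ [J1U _ /andP[Ge' _]]]]] := GK J JU.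
  apply: (cross_overlap aK (Upil _ IU).1 (Upil _ JU).1) => //.
  (* [e (G I)] is at most [e I2] and [e (G J)] at least [e J1], where [I2] and [J1] belong to [U]
     and keep the two pillars. Pillars do not decrease along [U], so [e I2 < e J1]. *)
  apply: (le_lt_trans Ge); apply: lt_le_trans Ge'.
  move: I2U J1U; rewrite !in_Up => /andP[I2U /eqP I2p] /andP[J1U /eqP J1p].
  have [//|/(Uinc _ _ J1U I2U)|eqe] := ltgtP (e I2) (e J1).
    rewrite I2p J1p => -[ltJI|[eqJI _]]; move: ltIJ; last by rewrite eqJI ltxx.
    by rewrite ltNge (ltW ltJI).
  by move: ltIJ; rewrite -I2p -J1p (e_inj _ _ I2U J1U eqe) ltxx.
have G_ov I J : I \in U -> J \in U -> I != J -> overlap (G I) (G J).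
  move=> IU JU IJ; have [lIJ|lJI|eqp] := ltgtP (pillar_of I) (pillar_of J).
  - exact: G_lt.
  - by apply: overlap_sym; apply: G_lt.
  - have [_] := gP (pillar_of I); rewrite /G -eqp; apply=> //; rewrite ?UUp//.
    by rewrite eqp UUp.
have G_inj : {in U &, injective G}.
  move=> I J IU JU GIJ; apply/eqP; apply: contraT => /(G_ov _ _ IU JU).
  by rewrite GIJ => -[]; rewrite eqxx.
have <- : #|` [fset G I | I in U]| = #|` U| by rewrite card_in_imfset.
apply: omega_ge.
  by apply/fsubsetP => _ /imfsetP[I /= IU ->]; have [/assignedP[]] := GK I IU.
move=> _ _ /imfsetP[I /= IU ->] /imfsetP[J /= JU ->] GIJ.
by apply: G_ov => //; apply: contraNneq GIJ => ->.
Qed.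

End OneSide.
End Assignment.

Lemma in_fset_sep (T : choiceType) (S : {fset T}) (Q : pred T) x :
  (x \in [fset y in S | Q y]) = (x \in S) && Q x.
Proof. by rewrite !inE. Qed.

(** * Degrees and the set of used colours *)

Section Degree.
Variables (R : realType) (Is : {fset R * R}) (A : pillar_triple R).
Local Notation P := (pillars A).
Local Notation psi := (colouring A).
Implicit Types (I J K : R * R) (p q : R) (c : nat).

Definition seen_colours J : {fset nat} :=
  codomf psi.[& [fset I in Is | (I.1 \in oitv J) || (I.2 \in oitv J)]].

Lemma degreeE J : degree Is A J = #|` seen_colours J|.
Proof. by []. Qed.

Lemma seen_coloursP J c : reflect
  (exists I x, [/\ I \in Is, x \in endpoints I, x \in oitv J & psi.[? I] = Some c])
  (c \in seen_colours J).
Proof.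
apply: (iffP (codomf_restrictP _ _ _)) => [[I]|[I [x [II xI xJ psiI]]]].
  rewrite in_fset_sep => /andP[II /orP[IJ|IJ]] psiI.
    by exists I, I.1; split; rewrite // !inE eqxx.
  by exists I, I.2; split; rewrite // !inE eqxx orbT.
exists I => //; rewrite in_fset_sep II /=.
by move: xI; rewrite in_fset2 => /orP[]/eqP xE; rewrite -xE xJ ?orbT.
Qed.

Lemma degree_mono J J' : J'.1 <= J.1 -> J.2 <= J'.2 ->
  (degree Is A J <= degree Is A J')%N.
Proof.
move=> l1 l2; rewrite !degreeE; apply: fsubset_leq_card.
apply/fsubsetP => c /seen_coloursP[I [x [II xI xJ psiI]]].
apply/seen_coloursP; exists I, x; split=> //.
by move: xJ; rewrite !in_itv /= => /andP[? ?]; rewrite (le_lt_trans l1)// (lt_le_trans _ l2).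
Qed.

Hypotheses (sysIs : interval_system Is) (pA : pillar_assignment Is A).

(** A maximum clique of [assigned Is A p] already takes [omega] different colours, which is the size
    of the palette. *)
Lemma palette_used p : p \in P -> codomf (phi_of Is A p) = palette Is A p.
Proof.
case: pA => _ _ _ + pP => /(_ p pP)[_ [cardC _] [dom sub proper] _ _].
apply/eqP; rewrite eqEfcard sub cardC /=.
have [Y [YX cY <-]] := omega_attained (assigned Is A p).
have Yphi I : I \in Y -> exists u : domf (phi_of Is A p), val u = I.
  move=> IY; have Iphi : I \in domf (phi_of Is A p) by rewrite dom (fsubsetP YX).
  by exists [` Iphi].
pose f I := odflt 0%N (phi_of Is A p).[? I].
have f_inj : {in Y &, injective f}.
  move=> I J IY JY; apply: contra_eq => IJ; have := cY I J IY JY IJ.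
  have [u uI] := Yphi I IY; have [v vJ] := Yphi J JY.
  by rewrite /f -uI -vJ -!Some_fnd => /proper.
have <- : #|` [fset f I | I in Y]| = #|` Y| by rewrite card_in_imfset.
apply: fsubset_leq_card; apply/fsubsetP => _ /imfsetP[I /= IY ->].
have [u uI] := Yphi I IY; apply/codomfP; exists I.
by rewrite /f -uI -Some_fnd.
Qed.

(* Hence the bound on chi also bounds the largest colour. *)
Lemma colours_initial c d : c \in codomf psi -> (0 < d <= c)%N -> d \in codomf psi.
Proof.
move=> /codomfP[I psiI] dc.
have [p [pP Ip cp]] := coloured_assigned pA psiI.
have /orP[] := smallest_outside_initial cp dc.
  move=> /codomf_restrictP[J _]; rewrite fnd_restrict; case: ifP => // _ psiJ.
  by apply/codomfP; exists J.
rewrite -/(palette Is A p) -palette_used// => /codomf_restrictP[J _ psiJ].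
by apply/codomfP; exists J.
Qed.

Lemma colour_gt0 c : c \in codomf psi -> (0 < c)%N.
Proof.
move=> /codomfP[I psiI]; have [p [_ _]] := coloured_assigned pA psiI.
by case/smallest_outsideP.
Qed.

Lemma colour_le_chi c : c \in codomf psi -> (c <= chi A)%N.
Proof.
move=> cpsi; rewrite -{1}(size_iota 1 c) /chi.
apply: uniq_leq_size (iota_uniq _ _) _ => d; rewrite mem_iota add1n ltnS => dc.
exact: colours_initial dc.
Qed.

End Degree.

(** * Adding one pillar inside an arch *)

Section AddPillar.
Variables (R : realType) (Is : {fset R * R}) (A : pillar_triple R).
Hypotheses (sysIs : interval_system Is) (pA : pillar_assignment Is A).
Variables (K : R * R) (p : R).
Hypotheses (aK : is_arch A K) (pK : p \in oitv K)
  (p_end : {in Is, forall I, p \notin endpoints I}).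
Local Notation P := (pillars A).
Local Notation psi := (colouring A).
Implicit Types (I J : R * R) (q r : R).

(** The order of [A] with [p] placed last; testing [y] first makes the relation reflexive at [p]. *)
Definition last_le : rel R :=
  fun x y => if y == p then true else if x == p then false else pillar_le A x y.

(** The colouring is a parameter because the new intervals and their palette are computed with
    [psi], before the extended colouring exists. *)
Definition add_triple (f : {fmap R * R -> nat}) : pillar_triple R :=
  PillarTriple (p |` P) last_le f.

Local Notation newly := (assigned Is (add_triple psi) p).

Let pNP : p \notin P.
Proof. by have [_ _ nK] := aK; apply/negP => /nK; rewrite pK. Qed.

Let neqp q : q \in P -> q != p.
Proof. by move=> qP; apply: contraNneq pNP => <-. Qed.

Let lt_last f q : q \in P -> pillar_lt (add_triple f) q p.
Proof. by move=> qP; rewrite /pillar_lt /= /last_le eqxx neqp. Qed.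

Let last_lt f q : q \in P -> pillar_lt (add_triple f) p q = false.
Proof.
by move=> qP; rewrite /pillar_lt /= /last_le (negPf (neqp qP)) eqxx andbF.
Qed.

Let lt_old f q r : q \in P -> r \in P ->
  pillar_lt (add_triple f) q r = pillar_lt A q r.
Proof.
by move=> qP rP; rewrite /pillar_lt /= /last_le (negPf (neqp qP)) (negPf (neqp rP)).
Qed.

Lemma newlyP f I : reflect
  [/\ I \in Is, p \in oitv I & {in P, forall q, q \notin oitv I}]
  (I \in assigned Is (add_triple f) p).
Proof.
apply: (iffP (assignedP _ _ _ _)) => -[II pI nI]; split=> // q.
  by move=> qP; apply: nI; [rewrite /= !inE qP orbT|exact: lt_last].
rewrite /= !inE => /orP[/eqP->|qP _]; last exact: nI.
by rewrite /pillar_lt eqxx.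
Qed.

Let assigned_old f q : q \in P ->
  assigned Is (add_triple f) q = assigned Is A q.
Proof.
move=> qP; apply/fsetP => I; apply/assignedP/assignedP => -[II qI nI]; split=> // r.
  by move=> rP; rewrite -(lt_old f)//; apply: nI; rewrite /= !inE rP orbT.
rewrite /= !inE => /orP[/eqP->|rP]; first by rewrite last_lt.
by rewrite lt_old//; apply: nI.
Qed.

Let foundation_old f q : q \in P -> foundation (add_triple f) q = foundation A q.
Proof.
move=> qP; rewrite /foundation; congr xget; apply/seteqP.
suff E : [fset r in pillars (add_triple f) | pillar_lt (add_triple f) r q] =
    [fset r in P | pillar_lt A r q].
  by split=> F; rewrite /is_foundation /= E.
apply/fsetP => r; rewrite !inE /=.
have [->|rp] /= := eqVneq r p; first by rewrite (negPf pNP) last_lt.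
by have [rP|//] /= := boolP (r \in P); rewrite lt_old.
Qed.

Let earlier_old f q : q \in P ->
  \bigcup_(r <- pillars (add_triple f) | pillar_lt (add_triple f) r q)
     assigned Is (add_triple f) r =
  \bigcup_(r <- P | pillar_lt A r q) assigned Is A r.
Proof.
move=> qP; apply/fsetP => I; apply/bigfcupP/bigfcupP => -[r /andP[]].
  rewrite in_fset1U => /orP[/eqP->|rP]; first by rewrite last_lt.
  by rewrite lt_old// assigned_old// => lrq Ir; exists r => //; rewrite rP.
move=> rP lrq Ir; exists r; last by rewrite assigned_old.
by rewrite in_fset1U rP orbT lt_old.
Qed.

Let newly_uncoloured I : I \in newly -> psi.[? I] = None.
Proof.
move=> /newlyP[_ _ nI]; case psiI: (psi.[? I]) => [c|//].
have [q [qP /assignedP[_ qI _] _]] := coloured_assigned pA psiI.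
by have := nI q qP; rewrite qI.
Qed.

Let restrict_ext (f g : {fmap R * R -> nat}) (D : {fset R * R}) :
  {in D, forall I, f.[? I] = g.[? I]} -> f.[& D] = g.[& D].
Proof.
move=> fg; apply/fmapP => I; rewrite !fnd_restrict.
by case: ifP => // /fg.
Qed.

(** A new interval contains [p] and no old pillar, so it cannot leave the gap [K]. Hence degrees
    outside [K] do not change. *)
Lemma newly_sub_arch I : I \in newly -> K.1 <= I.1 /\ I.2 <= K.2.
Proof.
move=> /newlyP[II pI nI]; have [_ eK _] := aK.
have /and3P[I0 _ I1] := sysIs.1 I II.
move: pK pI; rewrite !in_itv /= => /andP[Kp pK2] /andP[Ip pI2].
apply: gap_maximal I0 I1 nI _ _; first by rewrite fsetUC.
  exact: lt_trans pI2.
exact: lt_trans pK2.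
Qed.

Lemma arch_p01 : 0 < p < 1.
Proof. by have := is_arch_bounds pA aK; move: pK; rewrite in_itv /=; lra. Qed.

Let psi_before_last (f : {fmap R * R -> nat}) :
  (forall q I, q \in P -> I \in assigned Is A q -> f.[? I] = psi.[? I]) ->
  psi_before Is (add_triple f) p = psi.
Proof.
move=> fpsi; apply/fmapP => I; rewrite fnd_restrict; case: ifPn => [|nI].
  move=> /bigfcupP[q /andP[]]; rewrite in_fset1U => /orP[/eqP->|qP _].
    by rewrite /pillar_lt eqxx.
  by rewrite assigned_old// => Iq; apply: fpsi qP Iq.
case psiI: (psi.[? I]) => [c|//].
have [q [qP Iq _]] := coloured_assigned pA psiI.
case/negP: nI; apply/bigfcupP; exists q; last by rewrite assigned_old.
by rewrite in_fset1U qP orbT lt_last.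
Qed.

(** All pillars of [A] precede [p], so its foundation contains none of them. It follows that every
    colour forbidden to [p] is seen in [K]. *)
Lemma foundation_last_sub f x :
  x \in oitv (foundation (add_triple f) p) -> x \in oitv K.
Proof.
have : is_foundation (add_triple f) p (foundation (add_triple f) p).
  rewrite /foundation; apply: xgetPex.
  have [|F [pF eF nF _ _]] := @gap_exists R [fset q in pillars (add_triple f) |
       pillar_lt (add_triple f) q p] p arch_p01.
    by rewrite !inE /pillar_lt eqxx andbF.
  by exists F.
set F := foundation _ p => -[pF /fsubsetP eF nF].
have [_ eK _] := aK; have p01 := arch_p01.
have F0 z : z \in endpoints F -> 0 <= z <= 1.
  move=> /eF; rewrite in_fsetU in_fset_sep in_fset1U in_fset2.
  by move=> /orP[/andP[/orP[/eqP->|/(pillar01 pA) ?] _]|/orP[]/eqP->];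
    rewrite ?lexx ?ler01//; lra.
have /andP[F1 _] : 0 <= F.1 <= 1 by apply: F0; rewrite !inE eqxx.
have /andP[_ F2] : 0 <= F.2 <= 1 by apply: F0; rewrite !inE eqxx orbT.
move: pK pF; rewrite !in_itv /= => /andP[pK1 pK2] /andP[pF1 pF2].
have [||||KF FK] := @gap_maximal _ P K F _ F1 F2.
- by rewrite fsetUC.
- by move=> z zP; apply: nF; rewrite in_fset_sep in_fset1U zP orbT lt_last.
- exact: lt_trans pF2.
- exact: lt_trans pK2.
by move=> /andP[Fx xF]; rewrite (le_lt_trans KF Fx) (lt_le_trans xF FK).
Qed.

(** The new palette has [omega newly] colours, which bounds the increase of any degree. It consists
    of the smallest integers outside a set of at most [degree Is A K] colours, which bounds its
    largest element. *)
Lemma add_pillar : exists A' : pillar_triple R,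
  [/\ pillar_assignment Is A', extends A' A, pillars A' = p |` P,
      (forall J, (degree Is A' J <= degree Is A J + omega Is)%N) /\
      (forall J, J.2 <= K.1 \/ K.2 <= J.1 -> degree Is A' J = degree Is A J) &
      forall c, c \in codomf (colouring A') ->
        c \in codomf psi \/ (c <= degree Is A K + omega Is)%N].
Proof.
pose A0 := add_triple psi; pose C := palette Is A0 p.
have newlyI : newly `<=` Is by apply/fsubsetP => I /newlyP[].
have cardC : #|` C| = omega newly by rewrite card_smallest_outside.
have newly_p : {in newly, forall I, p \in oitv I} by move=> I /newlyP[].
have C_gt0 : {in C, forall c, (0 < c)%N} by move=> c /smallest_outsideP[].
have [phi st_phi] := structured_colouring_exists sysIs newlyI newly_p cardC C_gt0.
have [_ _ [dom_phi /fsubsetP codom_phi _] _ _] := st_phi.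
have in_phi I : (I \in domf phi) = (I \in newly) by rewrite dom_phi.
pose f := (psi + phi)%fset; pose A' := add_triple f.
have newlyE : assigned Is A' p = newly by apply/fsetP => I; apply/newlyP/newlyP.
have f_old q I : q \in P -> I \in assigned Is A q -> f.[? I] = psi.[? I].
  move=> qP Iq; rewrite fnd_cat in_phi ifF//; apply/negP => /newly_uncoloured.
  by have [c ->] := assigned_coloured pA qP Iq.
have f_new I : I \in newly -> f.[? I] = phi.[? I].
  by move=> Inew; rewrite fnd_cat in_phi Inew.
have f_colour I c : f.[? I] = Some c ->
    psi.[? I] = Some c \/ I \in newly /\ phi.[? I] = Some c.
  rewrite fnd_cat in_phi; case: ifP => [Inew|_]; first by right.
  by left.
have fext I c : psi.[? I] = Some c -> f.[? I] = Some c.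
  move=> psiI; have [q [qP Iq _]] := coloured_assigned pA psiI.
  by rewrite (f_old q).
have paletteE : palette Is A' p = C.
  have -> : C = smallest_outside (omega newly)
      (codomf (psi_before Is A0 p).[& foundation_cut Is A0 p]) by [].
  by rewrite /palette newlyE !psi_before_last.
(* A pillar placed last changes neither the intervals, the foundation nor the palette of an earlier
   one. *)
have before_old q : q \in P -> psi_before Is A' q = psi_before Is A q.
  move=> qP; rewrite /psi_before earlier_old//; apply: restrict_ext => I.
  by move=> /bigfcupP[r /andP[rP _]]; apply: f_old.
have palette_old q : q \in P -> palette Is A' q = palette Is A q.
  move=> qP; rewrite /palette (before_old q qP) (assigned_old _ qP).
  have -> : foundation_cut Is A' q = foundation_cut Is A q.
    by rewrite /foundation_cut (foundation_old _ qP).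
  reflexivity.
have phi_old q : q \in P -> phi_of Is A' q = phi_of Is A q.
  move=> qP; rewrite /phi_of assigned_old//; apply: restrict_ext => I.
  exact: f_old.
have phi_new : phi_of Is A' p = phi.
  apply/fmapP => I; rewrite /phi_of newlyE fnd_restrict.
  case: ifPn => [/f_new//|]; rewrite -dom_phi.
  by case: fndP.
have codom_new c : c \in C -> (c <= degree Is A K + omega Is)%N.
  move=> /smallest_outsideP[_ + _] => /leq_trans; apply.
  rewrite addnC leq_add//; last exact: omega_mono.
  rewrite degreeE; apply: fsubset_leq_card; apply/fsubsetP => d.
  move=> /codomf_restrictP[I Icut]; rewrite psi_before_last// => psiI.
  have [II Iends] : I \in Is /\ exists2 x, x \in endpoints I & x \in oitv (foundation A0 p).
    move: Icut; rewrite in_fset_sep => /andP[II cut]; split=> //.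
    have [I1|I1] := boolP (I.1 \in oitv (foundation A0 p)).
      by exists I.1; rewrite // in_fset2 eqxx.
    by exists I.2; [rewrite in_fset2 eqxx orbT|move: cut; rewrite (negPf I1)].
  have [x xI /foundation_last_sub xK] := Iends.
  by apply/seen_coloursP; exists I, x.
have PA' : pillars A' = p |` P by [].
have leA' : pillar_le A' = last_le by [].
have colA' : colouring A' = f by [].
have ltA' q : q \in P -> pillar_lt A' q p by apply: lt_last.
have asg_old q : q \in P -> assigned Is A' q = assigned Is A q by apply: assigned_old.
have new_none I : I \in newly -> psi.[? I] = None by apply: newly_uncoloured.
have new_arch I : I \in newly -> K.1 <= I.1 /\ I.2 <= K.2 by apply: newly_sub_arch.
have newly_le : (omega newly <= omega Is)%N by apply: omega_mono.
have domf_f I : (I \in domf f) = (I \in domf psi) || (I \in newly).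
  by rewrite mem_catf in_phi.
clearbody A' f C.
move: (newly) => X in st_phi dom_phi codom_phi in_phi newlyE f_new f_colour new_none
  new_arch newly_le domf_f cardC newlyI newly_p *.
have ext : extends A' A.
  split.
  - by rewrite PA'; exact: fsubsetU1.
  - move=> q r qP; rewrite PA' in_fsetD in_fset1U => /andP[/negPf rP].
    by rewrite rP orbF => /eqP->; apply: ltA'.
  - by move=> q r qP rP; rewrite leA' /last_le (negPf (neqp rP)) (negPf (neqp qP)).
  - by move=> I; rewrite colA'; apply: fext; rewrite Some_fnd.
exists A'; split; [|exact: ext|exact: PA'| |].
- split.
  + move=> q; rewrite PA' in_fset1U => /orP[/eqP->|].
      by split; first exact: arch_p01.
    by case: pA => + _ _ _; apply.
  + have [_ [le_refl le_asym le_trans le_total] _ _] := pA.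
    have in_P' q : q \in pillars A' -> q = p \/ q != p /\ q \in P.
      rewrite PA' in_fset1U; have [->|//] := eqVneq q p; first by left.
      by move=> qp qP; right.
    split; rewrite leA' /last_le.
    * move=> q /in_P'[->|[/negPf -> qP]]; rewrite ?eqxx//; exact: le_refl.
    * move=> q r /in_P'[->|[/negPf qp qP]] /in_P'[->|[/negPf rp rP]] //;
        rewrite ?eqxx ?qp ?rp ?andbF//; exact: le_asym.
    * move=> r q s /in_P'[->|[/negPf rp rP]] /in_P'[->|[/negPf qp qP]]
        /in_P'[->|[/negPf sp sP]]; rewrite ?eqxx ?qp ?rp ?sp//; exact: le_trans.
    * move=> q r /in_P'[->|[/negPf qp qP]] /in_P'[->|[/negPf rp rP]];
        rewrite ?eqxx ?qp ?rp ?orbT//; exact: le_total.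
  + have [_ _ dom_psi _] := pA; apply/fsetP => I; rewrite colA' domf_f.
    apply/orP/bigfcupP => [[Ipsi|Inew]|[q /andP[]]].
    * move: Ipsi; rewrite dom_psi => /bigfcupP[q /andP[qP _] Iq].
      by exists q; [rewrite PA' in_fset1U qP orbT|rewrite (asg_old q qP); exact: Iq].
    * by exists p; [rewrite PA' in_fset1U eqxx|rewrite newlyE; exact: Inew].
    * rewrite PA' in_fset1U => /orP[/eqP-> _|qP _]; first by rewrite newlyE; right.
      rewrite (asg_old q qP) => Iq; left; rewrite dom_psi; apply/bigfcupP.
      by exists q; rewrite ?qP.
  + move=> q; rewrite PA' in_fset1U => /orP[/eqP->|qP].
      by rewrite newlyE paletteE phi_new; exact: st_phi.
    rewrite (asg_old q qP) (palette_old q qP) (phi_old q qP).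
    by have [_ _ _] := pA; exact.
- split=> J.
    apply: (@leq_trans #|` seen_colours Is A J `|` C|).
      apply: fsubset_leq_card; apply/fsubsetP => c.
      move=> /seen_coloursP[I [x [II xI xJ]]]; rewrite colA' => /f_colour psiI.
      rewrite in_fsetU; apply/orP; case: psiI => [psiI|[_ phiI]].
        by left; apply/seen_coloursP; exists I, x.
      by right; apply: codom_phi; apply/codomfP; exists I.
    rewrite cardfsU degreeE (leq_trans (leq_subr _ _))// leq_add2l cardC.
    exact: newly_le.
  move=> JK; rewrite !degreeE; congr #|` _|; apply/fsetP => c.
  apply/seen_coloursP/seen_coloursP => -[I [x [II xI xJ]]]; rewrite ?colA' => psiI;
    exists I, x; split=> //.
    case: (f_colour _ _ psiI) => // -[/new_arch[KI1 KI2] _].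
    have lI := interval_lt sysIs II; have [lK _ _] := aK.
    move: xI xJ; rewrite in_fset2 in_itv /= => /orP[]/eqP-> /andP[J1 J2];
      exfalso; case: JK; lra.
  exact: fext.
- move=> c; rewrite colA' => /codomfP[I /f_colour[psiI|[_ phiI]]].
    by left; apply/codomfP; exists I.
  by right; apply/codom_new/codom_phi/codomfP; exists I.
Qed.

End AddPillar.

(** * Splitting an arch along a balanced search tree *)

Section Split.
Variables (R : realType) (Is : {fset R * R}).
Hypothesis sysIs : interval_system Is.
Implicit Types (A : pillar_triple R) (I J K : R * R) (s : seq R).

Lemma extends_refl A : extends A A.
Proof.
split=> //; first by move=> p q _; rewrite fsetDv inE.
by move=> I; rewrite -Some_fnd.
Qed.

Lemma extends_trans A1 A2 A3 :
  extends A2 A1 -> extends A3 A2 -> extends A3 A1.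
Proof.
move=> [sub12 lt12 le12 col12] [sub23 lt23 le23 col23].
have in12 := fsubsetP sub12; have in23 := fsubsetP sub23.
split.
- exact: fsubset_trans sub23.
- move=> p q pP1; rewrite in_fsetD => /andP[qP1 qP3].
  have [qP2|qP2] := boolP (q \in pillars A2); last first.
    by apply: lt23; rewrite ?in12// in_fsetD qP2.
  have : pillar_lt A2 p q by apply: lt12; rewrite // in_fsetD qP1.
  by rewrite /pillar_lt le23// in12.
- by move=> p q pP1 qP1; rewrite le23 ?in12// le12.
- move=> I; have := col12 I; case: fndP => // I2 [<-].
  exact: (col23 [` I2]).
Qed.

Definition avoids J s := {in s, forall q, q \notin oitv J}.

(** The list may have repetitions; strict counts on both sides stay within half. So a list shorter
    than [2 ^ k.+1] leaves two parts shorter than [2 ^ k]. *)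
Lemma median s : s != [::] -> exists2 q, q \in s &
  (count (< q) s <= (size s)./2)%N /\ (count (> q) s <= (size s)./2)%N.
Proof.
move=> s0; pose t := sort <=%R s; pose h := (size s)./2.
have hs : (h < size s)%N by rewrite /h; case: s s0 {t h} => //= x s _; lia.
have tE : perm_eq t s by rewrite perm_sort.
have st : size t = size s by rewrite size_sort.
pose q := nth 0 t h; exists q; first by rewrite -(perm_mem tE) mem_nth ?st.
have sorted_t : sorted <=%R t by apply: sort_sorted; apply: le_total.
have le_t i j : (i <= j)%N -> (j < size t)%N -> nth 0 t i <= nth 0 t j.
  move=> ij jt; apply: (sorted_leq_nth le_trans lexx 0 sorted_t); rewrite ?inE//.
  exact: leq_ltn_trans jt.
split; rewrite -(permP tE) -(cat_take_drop h t) count_cat.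
  rewrite [X in (_ + X)%N](_ : _ = 0%N).
    by rewrite addn0 (leq_trans (count_size _ _))// size_take st hs.
  apply/eqP; rewrite -leqn0 leqNgt -has_count; apply/hasPn => x /(nthP 0)[i].
  rewrite size_drop => ih <-; rewrite nth_drop /= -leNgt le_t ?leq_addr//.
  by rewrite -ltn_subRL.
rewrite [X in (X + _)%N](_ : _ = 0%N).
  rewrite add0n -/q (drop_nth 0) ?st//= ltxx add0n.
  by rewrite (leq_trans (count_size _ _))// size_drop st /h; lia.
apply/eqP; rewrite -leqn0 leqNgt -has_count; apply/hasPn => x /(nthP 0)[i].
rewrite size_take st hs => ih <-; rewrite nth_take//= -leNgt le_t//; last by rewrite st.
exact: ltnW.
Qed.

Local Notation w := (omega Is).

(* The pillars of s are added in the order of a balanced binary search tree, so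
   that each piece of K only meets the new intervals of k of them. *)
Lemma split_arch k A K s (S N : nat) :
  pillar_assignment Is A -> is_arch A K ->
  {in s, forall q, q \in oitv K /\ {in Is, forall I, q \notin endpoints I}} ->
  (size s < 2 ^ k)%N ->
  (forall J, K.1 <= J.1 -> J.2 <= K.2 -> avoids J s -> (degree Is A J <= S)%N) ->
  (degree Is A K <= N)%N ->
  exists A', [/\ pillar_assignment Is A', extends A' A,
    [/\ forall q, q \in s -> q \in pillars A',
      forall q, q \in pillars A' -> q \in pillars A \/ q \in oitv K &
      forall c, c \in codomf (colouring A') ->
        c \in codomf (colouring A) \/ (c <= N + k * w)%N],
    (forall J, K.1 <= J.1 -> J.2 <= K.2 -> avoids J s ->
       (degree Is A' J <= S + k * w)%N) &
    forall J, J.2 <= K.1 \/ K.2 <= J.1 -> degree Is A' J = degree Is A J].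
Proof.
elim: k A K s S N => [|k IH] A K s S N pA aK sK sk dS dN.
  exists A; split=> //; first exact: extends_refl.
    split=> //; [|by left|by left].
    by case: s sk {sK dS} => //= ? ?.
  by move=> J *; rewrite mul0n addn0; apply: dS.
have [s0|s0] := eqVneq s [::].
  exists A; split=> //; first exact: extends_refl.
    by split=> //; [rewrite s0|left|left].
  by move=> J *; rewrite (leq_trans (dS _ _ _ _))// leq_addr.
have [q qs [cl cr]] := median s0; have [qK q_end] := sK q qs.
have [A1 [pA1 eA1 P1 [d1 d1out] c1]] := add_pillar sysIs pA aK qK q_end.
have [lK /fsubsetP eK nK] := aK.
have q12 : K.1 < q < K.2 by move: qK; rewrite in_itv.
have [q1 q2] := andP q12.
have half : (2 ^ k.+1)%N = (2 ^ k + 2 ^ k)%N by rewrite expnS; lia.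
pose s1 := [seq x <- s | x < q]; pose s2 := [seq x <- s | q < x].
have szs1 : (size s1 < 2 ^ k)%N.
  by rewrite size_filter (leq_ltn_trans cl)//; lia.
have szs2 : (size s2 < 2 ^ k)%N.
  by rewrite size_filter (leq_ltn_trans cr)//; lia.
pose K1 := (K.1, q); pose K2 := (q, K.2).
have aK1 : is_arch A1 K1.
  split=> //=.
    apply/fsubsetP => x; rewrite in_fset2 P1 in_fsetU in_fset1U => /orP[]/eqP->.
      have := eK K.1; rewrite in_fset2 eqxx in_fsetU => /(_ isT)/orP[->//|->].
      by rewrite !orbT.
    by rewrite eqxx !orbT.
  move=> x; rewrite P1 in_fset1U => /orP[/eqP->|/nK].
    by rewrite in_itv /= ltxx andbF.
  by rewrite !in_itv /=; apply: contra => /andP[-> /= ] /lt_trans; apply.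
have avoid1 J : J.2 <= q -> avoids J s1 -> avoids J s.
  move=> Jq Js x xs; have [xq|xq] := ltP x q.
    by apply: Js; rewrite mem_filter xq.
  by rewrite in_itv /= negb_and -!leNgt (le_trans Jq xq) orbT.
have avoid2 J : q <= J.1 -> avoids J s2 -> avoids J s.
  move=> Jq Js x xs; have [xq|xq] := ltP q x.
    by apply: Js; rewrite mem_filter xq.
  by rewrite in_itv /= negb_and -!leNgt (le_trans xq Jq).
(* Each half has one level fewer and bounds [S] and [N] larger by [w], so [S + k * w] and
   [N + k * w] come out the same. *)
have [||||||A2 [pA2 eA2 [s1P P2 c2] d2 d2out]] := IH A1 K1 s1 (S + w)%N (N + w)%N => //.
- move=> x; rewrite mem_filter => /andP[xq /sK[xK xend]]; split=> //.
  by move: xK; rewrite !in_itv /= => /andP[->].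
- move=> J /= J1 J2 Js1; rewrite (leq_trans (d1 J))// leq_add2r dS//.
    exact: (le_trans J2 (ltW q2)).
  exact: avoid1.
- rewrite (leq_trans (d1 _))// leq_add2r (leq_trans _ dN)//.
  by apply: degree_mono => //=; apply: ltW.
have P12 : {in pillars A1, forall x, x \in pillars A2}.
  by case: eA2 => /fsubsetP.
(* Pillars added on the left stay in [K1], so the right half is still an arch, and its degrees are
   those after the insertion of [q] alone. *)
have aK2 : is_arch A2 K2.
  split=> //=.
    apply/fsubsetP => x; rewrite in_fset2 in_fsetU => /orP[]/eqP->.
      by rewrite P12 ?orbT// P1 in_fset1U eqxx.
    have := eK K.2; rewrite in_fset2 eqxx orbT in_fsetU => /(_ isT)/orP[->//|KP].
    by rewrite P12 ?orbT// P1 in_fset1U KP orbT.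
  move=> x /P2[|]; last first.
    by rewrite !in_itv /= => /andP[_ xq]; rewrite negb_and -!leNgt (ltW xq).
  rewrite P1 in_fset1U => /orP[/eqP->|/nK]; first by rewrite in_itv /= ltxx.
  by rewrite !in_itv /=; apply: contra => /andP[qx ->]; rewrite (lt_trans q1 qx).
have d2K2 J : q <= J.1 -> degree Is A2 J = degree Is A1 J.
  by move=> qJ; apply: d2out; right.
have [||||||A3 [pA3 eA3 [s2P P3 c3] d3 d3out]] := IH A2 K2 s2 (S + w)%N (N + w)%N => //.
- move=> x; rewrite mem_filter => /andP[xq /sK[xK xend]]; split=> //.
  by move: xK; rewrite !in_itv /= => /andP[_ ->]; rewrite xq.
- move=> J /= J1 J2 Js2; rewrite d2K2// (leq_trans (d1 J))// leq_add2r dS//.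
    exact: (le_trans (ltW q1) J1).
  exact: avoid2.
- rewrite d2K2//= (leq_trans (d1 _))// leq_add2r (leq_trans _ dN)//.
  by apply: degree_mono => //=; apply: ltW.
have P23 : {in pillars A2, forall x, x \in pillars A3}.
  by case: eA3 => /fsubsetP.
exists A3; split=> //.
- exact: extends_trans (extends_trans eA1 eA2) eA3.
- split.
  + move=> x xs; have [xq|qx|->] := ltgtP x q.
    * by apply/P23/s1P; rewrite mem_filter xq.
    * by apply: s2P; rewrite mem_filter qx.
    * by apply/P23/P12; rewrite P1 in_fset1U eqxx.
  + move=> x /P3[/P2[|]|].
    * by rewrite P1 in_fset1U => /orP[/eqP->|]; [right|left].
    * by rewrite !in_itv /= => /andP[-> /lt_trans xq]; right; rewrite xq.
    * by rewrite !in_itv /= => /andP[/(lt_trans q1) -> ->]; right.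
  + move=> c /c3[/c2[/c1[|cN]|cN]|cN]; [by left|right..]; last 2 first.
    * by rewrite (leq_trans cN)// mulSn; lia.
    * by rewrite (leq_trans cN)// mulSn; lia.
    * by rewrite (leq_trans cN)// mulSn; lia.
(* A piece that avoids [q] lies on one side of it, and the recursion on the other side leaves its
   degree alone. *)
- move=> J J1 J2 Js; have := Js q qs.
  rewrite in_itv /= negb_and -!leNgt mulSn addnA => /orP[qJ|Jq].
    by apply: d3 => // x; rewrite mem_filter => /andP[_ /Js].
  rewrite d3out; last by left.
  by apply: d2 => // x; rewrite mem_filter => /andP[_ /Js].
- move=> J JK; rewrite d3out ?d2out ?d1out//.
    by case: JK => JK; [left|right=> /=; apply: le_trans JK; apply: ltW].
  by case: JK => JK; [left=> /=; apply: (le_trans JK); apply: ltW|right].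
Qed.

End Split.

(** * Greedy cuts of prescribed degree *)

Lemma fsubset_lt_card (T : choiceType) (S1 S2 : {fset T}) x :
  {subset S1 <= S2} -> x \in S2 -> x \notin S1 -> (#|` S1| < #|` S2|)%N.
Proof.
move=> /fsubsetP S12 xS2 xS1; rewrite (cardfsD1 x S2) xS2 ltnS.
by apply: fsubset_leq_card; rewrite fsubsetD1 S12.
Qed.

Section Greedy.
Variables (R : realType) (Is : {fset R * R}) (A : pillar_triple R).
Hypothesis sysIs : interval_system Is.
Local Notation psi := (colouring A).
Implicit Types (a b c : R) (I J : R * R).

Definition all_endpoints : {fset R} := \bigcup_(I <- Is) endpoints I.

Lemma all_endpointsP x :
  reflect (exists2 I, I \in Is & x \in endpoints I) (x \in all_endpoints).
Proof.
apply: (iffP (bigfcupP _ _ _ _)) => [[I /andP[II _] xI]|[I II xI]]; exists I => //.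
by rewrite II.
Qed.

Definition endpoints_in a b := [fset x in all_endpoints | (a < x) && (x < b)].

Lemma seen_endpoint a b : (0 < degree Is A (a, b))%N ->
  exists x, x \in endpoints_in a b.
Proof.
rewrite degreeE cardfs_gt0 => /fset0Pn[c /seen_coloursP[I [x [II xI xJ _]]]].
exists x; rewrite in_fset_sep; apply/andP; split; last by rewrite in_itv in xJ.
by apply/all_endpointsP; exists I.
Qed.

(** An endpoint belongs to one interval only, so moving the right end past the last endpoint loses
    at most one colour. *)
Lemma drop_last_endpoint a b : (0 < degree Is A (a, b))%N ->
  exists c, [/\ a < c < b, c \notin all_endpoints,
    (degree Is A (a, b) <= (degree Is A (a, c)).+1)%N &
    (#|` endpoints_in a c| < #|` endpoints_in a b|)%N].
Proof.
move=> /seen_endpoint[x0 /fset_max[v]].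
rewrite in_fset_sep => /andP[vV /andP[av vb]] vmax.
(* [u] is the endpoint preceding [v], or [a] if there is none; the new end [c] is chosen between [u]
   and [v]. *)
have [|u] := @fset_max R (a |` endpoints_in a v) a; first by rewrite in_fset1U eqxx.
rewrite in_fset1U in_fset_sep => uV umax.
have uv : u < v by case/orP: uV => [/eqP->//|/andP[_ /andP[]]].
have au : a <= u by case/orP: uV => [/eqP->//|/andP[_ /andP[/ltW]]].
have [c /andP[uc cv] cV] := avoid_finite all_endpoints uv.
have [Iv IvI vIv] := all_endpointsP _ vV.
exists c; split=> //.
- by rewrite (le_lt_trans au)// (lt_trans cv).
(* [Iv] may be uncoloured; then [colour_of] yields 0, which only enlarges the upper bound. *)
- rewrite !degreeE; apply: (@leq_trans #|` colour_of A Iv |` seen_colours Is A (a, c)|).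
    apply: fsubset_leq_card; apply/fsubsetP => d /seen_coloursP[I [x [II xI xab psiI]]].
    have xV : x \in all_endpoints by apply/all_endpointsP; exists I.
    move: xab; rewrite in_itv /= => /andP[ax xb].
    have xv : x <= v by apply: vmax; rewrite in_fset_sep xV ax.
    rewrite in_fset1U; apply/orP; move: xv; rewrite le_eqVlt => /predU1P[xv|xv].
      left; suff <- : I = Iv by rewrite /colour_of psiI.
      by apply: (endpoint_inj sysIs II IvI xI); rewrite xv.
    right; apply/seen_coloursP; exists I, x; split=> //.
    have xu : x <= u by apply: umax; rewrite in_fset1U in_fset_sep xV ax xv orbT.
    by rewrite in_itv /= ax (le_lt_trans xu).
  by rewrite cardfsU1; case: (_ \notin _).
- apply: (@fsubset_lt_card _ _ _ v) => [x||].
  + rewrite !in_fset_sep => /andP[-> /andP[-> xc]] /=.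
    exact: lt_trans (lt_trans xc cv) vb.
  + by rewrite in_fset_sep vV av.
  + by rewrite in_fset_sep negb_and vV av /= -leNgt ltW.
Qed.

(** A discrete intermediate value argument: the degree falls by at most one at each endpoint
    passed. *)
Lemma cut_at_degree a b (S : nat) : (S < degree Is A (a, b))%N ->
  exists c, [/\ a < c < b, c \notin all_endpoints & degree Is A (a, c) = S].
Proof.
have [n] := ubnP #|` endpoints_in a b|; elim: n b => // n IH b.
rewrite ltnS => bn Sab.
have [c [/andP[ac cb] cV dc cc]] := drop_last_endpoint (leq_ltn_trans (leq0n _) Sab).
have [Sc|Sc] := ltnP S (degree Is A (a, c)).
  have [d [/andP[ad dc'] dV dS]] := IH c (leq_trans cc bn) Sc.
  by exists d; split=> //; rewrite ad (lt_trans dc').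
by exists c; split; rewrite ?ac//; apply/eqP; rewrite eqn_leq Sc; lia.
Qed.

(** Pieces between consecutive cuts have degree exactly [S]: the lower bound serves the counting,
    the upper bound the later insertions. The last piece is only bounded above. As [0 < S], each cut
    passes an endpoint, so the process stops. *)
Lemma greedy_cuts a b (S : nat) : (0 < S)%N -> a < b ->
  exists s : seq R, [/\ path <%R a s,
    {in s, forall c, c < b /\ c \notin all_endpoints},
    forall i, (i < size s)%N ->
      (S <= degree Is A (nth 0%R (a :: s) i, nth 0%R (a :: s) i.+1))%N &
    forall J, a <= J.1 -> J.2 <= b -> avoids J s -> (degree Is A J <= S)%N].
Proof.
move=> S0; have [n] := ubnP #|` endpoints_in a b|; elim: n a => // n IH a.
rewrite ltnS => an ab.
have [dS|] := leqP (degree Is A (a, b)) S.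
  by exists [::]; split=> // J J1 J2 _; apply: leq_trans dS; apply: degree_mono.
move=> /cut_at_degree[c [/andP[ac cb] cV dc]].
have [x] : exists x, x \in endpoints_in a c by apply: seen_endpoint; rewrite dc.
rewrite in_fset_sep => /andP[xV /andP[ax xc]].
have cn : (#|` endpoints_in c b| < n)%N.
  apply: leq_trans an; apply: (@fsubset_lt_card _ _ _ x) => [y||].
  - by rewrite !in_fset_sep => /andP[-> /andP[/(lt_trans ac) -> ->]].
  - by rewrite in_fset_sep xV ax (lt_trans xc).
  - rewrite in_fset_sep; apply/negP => /andP[_ /andP[cx _]].
    by rewrite ltNge (ltW xc) in cx.
have [s [ps sb sd sJ]] := IH c cn cb.
exists (c :: s); split=> /=.
- by rewrite ac.
- by move=> y; rewrite inE => /predU1P[->|/sb].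
- by case=> [_|i]; [rewrite dc|exact: sd].
- move=> J J1 J2 Js; have := Js c (mem_head _ _).
  rewrite in_itv /= negb_and -!leNgt => /orP[cJ|Jc].
    by apply: sJ => // y ys; apply: Js; rewrite inE ys orbT.
  by rewrite -dc; apply: degree_mono.
Qed.

End Greedy.

(** * Counting the colours seen in the pieces of an arch *)

Section Pieces.
Variables (R : realType) (Is : {fset R * R}) (A : pillar_triple R).
Hypotheses (sysIs : interval_system Is) (pA : pillar_assignment Is A).
Variables (K : R * R).
Hypothesis aK : is_arch A K.
Local Notation psi := (colouring A).
Local Notation w := (omega Is).
Implicit Types (I J : R * R).

(** A coloured interval with its left end in an arch has its pillar to the right of it, so [fst] and
    [snd] sort the seen colours by the side of their pillar. *)
Definition side_colours (e : R * R -> R) J : {fset nat} :=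
  codomf psi.[& [fset I in Is | e I \in oitv J]].

Lemma side_coloursP e J c : reflect
  (exists I, [/\ I \in Is, e I \in oitv J & psi.[? I] = Some c])
  (c \in side_colours e J).
Proof.
apply: (iffP (codomf_restrictP _ _ _)) => [[I]|[I [II IJ psiI]]].
  by rewrite in_fset_sep => /andP[II IJ] psiI; exists I.
by exists I => //; rewrite in_fset_sep II.
Qed.

Lemma seen_side J : seen_colours Is A J = side_colours fst J `|` side_colours snd J.
Proof.
apply/fsetP => c; rewrite in_fsetU; apply/seen_coloursP/orP.
  move=> [I [x [II + xJ psiI]]]; rewrite in_fset2 => /orP[]/eqP xI.
    by left; apply/side_coloursP; exists I; rewrite -xI.
  by right; apply/side_coloursP; exists I; rewrite -xI.
case=> /side_coloursP[I [II IJ psiI]].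
  by exists I, I.1; split; rewrite // in_fset2 eqxx.
by exists I, I.2; split; rewrite // in_fset2 eqxx orbT.
Qed.

(** A common colour would have a single pillar, lying to the right of [K] because of [I] and to the
    left because of [J]. *)
Lemma sides_disjoint : [disjoint side_colours fst K & side_colours snd K].
Proof.
apply/fdisjointP => c /side_coloursP[I [II IK psiI]]; apply/negP.
move=> /side_coloursP[J [JI JK psiJ]].
have [p [pP Ip _]] := coloured_assigned pA psiI.
have [q [qP Jq _]] := coloured_assigned pA psiJ.
have I1 : I.1 \in endpoints I by rewrite in_fset2 eqxx.
have J2 : J.2 \in endpoints J by rewrite in_fset2 eqxx orbT.
have pq := same_colour_same_pillar pA aK pP qP Ip Jq I1 J2 IK JK.
have [_ _ /(_ p pP)] := aK.
have [_ pI _] := assignedP _ _ _ _ Ip; have [_ qJ _] := assignedP _ _ _ _ Jq.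
move: qJ pI IK JK; rewrite -pq ?psiI//.
by rewrite !in_itv /= => /andP[? ?] /andP[? ?] /andP[? ?] /andP[? ?];
  rewrite negb_and -!leNgt => /orP[]; lra.
Qed.

Section Side.
Variable e : R * R -> R.
Hypothesis e_side : e = fst \/ e = snd.
Variables (r : nat) (x : nat -> R).
Hypotheses (x0 : K.1 <= x 0%N) (xr : x r <= K.2)
  (x_mono : forall i j, (i <= j <= r)%N -> x i <= x j).

Local Notation piece i := (x i, x i.+1).
Local Notation C := (side_colours e K).

Lemma piece_sub (i : 'I_r) y : y \in oitv (piece i) -> y \in oitv K.
Proof.
rewrite !in_itv /= => /andP[xy yx].
have xi : x 0%N <= x i by apply: x_mono; rewrite /= ltnW.
have xi1 : x i.+1 <= x r by apply: x_mono; rewrite leqnn andbT.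
by rewrite (le_lt_trans x0 (le_lt_trans xi xy)) (lt_le_trans yx (le_trans xi1 xr)).
Qed.

Lemma piece_side_sub (i : 'I_r) : side_colours e (piece i) `<=` C.
Proof.
apply/fsubsetP => c /side_coloursP[I [II /piece_sub IK psiI]].
by apply/side_coloursP; exists I.
Qed.

(** Along a strictly increasing chain of pairs the pieces order the endpoints, and the ranks order
    the pillars and then the colours, as [card_side_chain] asks. *)
Lemma sum_side_colours :
  (\sum_(i < r) #|` side_colours e (piece i)| <= w * (r + #|` C|))%N.
Proof.
have /choice[rep repP] : forall c : C, exists I,
    [/\ I \in Is, e I \in oitv K & psi.[? I] = Some (val c)].
  by move=> c; apply/side_coloursP/valP.
pose pil c := pillar_of Is A (rep c).
pose lexlt (c d : C) := (pil c < pil d) || (pil c == pil d) && (val c < val d)%N.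
have lexI c : lexlt c c = false by rewrite /lexlt ltxx ltnn andbF.
have lexT c d f : lexlt c d -> lexlt d f -> lexlt c f.
  rewrite /lexlt => /orP[cd|/andP[/eqP-> cd]] /orP[df|/andP[/eqP df df']].
  - by rewrite (lt_trans cd df).
  - by rewrite -df cd.
  - by rewrite df.
  - by rewrite df eqxx (ltn_trans cd df') orbT.
have lexN c d : c != d -> lexlt c d || lexlt d c.
  rewrite /lexlt; case: ltgtP => // _ cd; rewrite /= -neq_ltn.
  by apply: contra_neq cd; apply: val_inj.
(* Ranks turn the lexicographic order into column indices for the matrix bound. *)
pose rank (c : C) := #|[pred d : C | lexlt d c]|.
have rank_mono c d : lexlt c d -> (rank c < rank d)%N.
  move=> cd; apply: proper_card; apply/properP; split.
    by apply/fintype.subsetP => f; rewrite !inE => /lexT; apply.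
  by exists c; rewrite !inE ?lexI.
have rank_lt c d : (rank c < rank d)%N -> lexlt c d.
  have [->|/lexN/orP[//|/rank_mono]] := eqVneq c d; first by rewrite ltnn.
  by move=> /ltn_trans/[apply]; rewrite ltnn.
have rankC c : (rank c < #|` C|)%N.
  rewrite cardfE; apply: proper_card; apply/properP; split.
    exact/fintype.subsetP.
  by exists c; rewrite // !inE lexI.
pose Q (u : 'I_r * C) := val u.2 \in side_colours e (piece u.1).
pose E := {u : 'I_r * C | Q u}.
have cardE : (\sum_(i < r) #|` side_colours e (piece i)| = #|{: E}|)%N.
  rewrite card_sig -sum1_card -(pair_big_dep xpredT (fun i c => Q (i, c)) (fun _ _ => 1%N)) /=.
  apply: eq_bigr => i _; rewrite sum1_card.
  transitivity #|[set c : C | Q (i, c)]|; last by apply: eq_card => c; rewrite !inE.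
  rewrite -(card_fset_image [set c : C | Q (i, c)] val_inj).
    congr #|` _|; apply/fsetP => c; apply/idP/imfsetP => [ci|[d /=]].
    have cC := fsubsetP (piece_side_sub i) _ ci.
    by exists [` cC]; rewrite //= inE.
  by rewrite inE => + ->.
rewrite cardE.
have /choice[rp rpP] : forall u : E, exists I,
    [/\ I \in Is, e I \in oitv (piece (val u).1) & psi.[? I] = Some (val (val u).2)].
  by move=> u; apply/side_coloursP/(valP u).
pose b (u : E) := Ordinal (rankC (val u).2).
apply: (@card_bounded_chains E _ _ _ (fun u => (val u).1) b).
  move=> u v /pair_equal_spec[uv1 /(congr1 val) /= uv2]; apply/val_inj.
  have uv2' : (val u).2 = (val v).2.
    apply/eqP; apply: contraT => /lexN/orP[]/rank_mono; by rewrite uv2 ltnn.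
  by rewrite (surjective_pairing (val u)) (surjective_pairing (val v)) uv1 uv2'.
move=> U Uc.
have e_lt (u v : E) : ((val u).1 < (val v).1)%N -> e (rp u) < e (rp v).
  move=> uv; have [_ + _] := rpP u; have [_ + _] := rpP v.
  rewrite !in_itv /= => /andP[xv _] /andP[_ ux]; apply: (lt_trans ux).
  by apply: le_lt_trans xv; apply: x_mono; rewrite uv ltnW.
have rp_inj : {in U &, injective rp}.
  move=> u v uU vU uv; apply/eqP; apply: contraT => /(Uc _ _ uU vU).
  by case/orP=> /andP[/e_lt]; rewrite uv ltxx.
(* The interval seen in the piece may differ from the representative of its colour, but equal
   colours in an arch have equal pillars. *)
have rp_pil (u : E) : exists p, [/\ p \in pillars A, rp u \in assigned Is A p & pil (val u).2 = p].
  have [_ uK psiu] := rpP u; have [p [pP up _]] := coloured_assigned pA psiu.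
  exists p; split=> //; have [_ cK psic] := repP (val u).2.
  have [q [qP cq _]] := coloured_assigned pA psic.
  rewrite /pil (pillar_ofE pA qP cq).
  apply: (same_colour_same_pillar pA aK qP pP cq up (side_endpoint e_side _)
    (side_endpoint e_side _) cK (piece_sub uK)).
  by rewrite psic psiu.
have <- : #|` [fset rp u | u in U]| = #|U|.
  by rewrite card_in_imfset// -[RHS]card_finset card_imfset.
apply: (card_side_chain sysIs pA e_side aK).
  move=> _ /imfsetP[u /= uU ->]; have [_ uK _] := rpP u.
  by have [p [pP up _]] := rp_pil u; split; [exists p|exact: piece_sub uK].
move=> _ _ /imfsetP[u /= uU ->] /imfsetP[v /= vU ->] euv.
have [p [pP up pu]] := rp_pil u; have [q [qP vq qv]] := rp_pil v.
have [_ _ psiu] := rpP u; have [_ _ psiv] := rpP v.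
rewrite (pillar_ofE pA pP up) (pillar_ofE pA qP vq) /colour_of psiu psiv /=.
have uv : u != v by apply: contraTneq euv => ->; rewrite ltxx.
have /orP[/andP[_ /rank_lt]|/andP[/e_lt]] := Uc _ _ uU vU uv; last first.
  by rewrite ltNge (ltW euv).
by rewrite /lexlt pu qv => /orP[|/andP[/eqP]]; [left|right].
Qed.

End Side.

(** The term in [r] is paid once for each side, whereas the colour counts of the disjoint sides add
    up to the degree of [K]. *)
Lemma sum_degrees (r : nat) (x : nat -> R) :
  K.1 <= x 0%N -> x r <= K.2 -> (forall i j, (i <= j <= r)%N -> x i <= x j) ->
  (\sum_(i < r) degree Is A (x i, x i.+1) <= 2 * w * r + w * degree Is A K)%N.
Proof.
move=> x0 xr xm.
have s1 := sum_side_colours (or_introl erefl) x0 xr xm.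
have s2 := sum_side_colours (or_intror erefl) x0 xr xm.
have dK : degree Is A K = (#|` side_colours fst K| + #|` side_colours snd K|)%N.
  by rewrite degreeE seen_side cardfsU (disjoint_fsetI0 sides_disjoint) cardfs0 subn0.
apply: (@leq_trans (\sum_(i < r) (#|` side_colours fst (x i, x i.+1)| +
                                  #|` side_colours snd (x i, x i.+1)|))).
  by apply: leq_sum => i _; rewrite degreeE seen_side cardfsU leq_subr.
rewrite big_split /= (leq_trans (leq_add s1 s2))// dK; nia.
Qed.

End Pieces.

(** * Completion under numerical conditions on [k], [D] and [T] *)

Section Completion.
Variables (R : realType) (Is : {fset R * R}) (w k D T : nat).
Hypotheses (sysIs : interval_system Is) (w_gt0 : (0 < w)%N) (omega_w : (omega Is <= w)%N).
Hypotheses (kD : ((k + 3) * w <= D)%N) (k_large : (w * (k + 3) + 2 <= 2 ^ k)%N)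
  (DT : (D + k * w <= T)%N).
Implicit Types (A : pillar_triple R) (I J K : R * R).

(** The invariant of the completion. Every pillar-free [J] inside the unit interval is covered, so
    arches created by a split need no separate treatment. Colours are bounded in size, which is what
    a palette bound provides. *)
Definition admissible A :=
  [/\ pillar_assignment Is A,
      forall J, 0 <= J.1 -> J.2 <= 1 -> avoids J (pillars A) -> (degree Is A J <= D)%N &
      forall c, c \in codomf (colouring A) -> (c <= T)%N].

Lemma levels_lt : (k * w < D)%N.
Proof. by apply: leq_trans kD; rewrite ltn_pmul2r// addn3; lia. Qed.

(* With S = D - k w and e = S - 2w >= w, the inequality reads r e <= w (e + (k + 2) w). *)
Lemma few_cuts (r : nat) :
  (r * (D - k * w) <= 2 * w * r + w * D)%N -> (r.+1 < 2 ^ k)%N.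
Proof.
move=> rD; rewrite ltnNge; apply/negP => rk.
have [e [De we]] : exists e, D = (e + (k + 2) * w)%N /\ (w <= e)%N.
  by exists (D - (k + 2) * w)%N; split; nia.
have SE : (D - k * w = e + 2 * w)%N by rewrite De; nia.
move: rD; rewrite SE De => rD.
have re : (r * e <= w * e + w * w * (k + 2))%N by nia.
have rw : (w * (k + 2) + w + 1 <= r)%N by nia.
have : ((w * (k + 2) + w + 1) * e <= w * e + w * w * (k + 2))%N.
  by apply: leq_trans re; rewrite leq_mul2r rw orbT.
(* After cancelling [w * e], the bound [w <= e] makes the left side exceed [w * w * (k + 2)] by at
   least [w]. *)
nia.
Qed.

Lemma admissible_step A I : admissible A -> I \in Is ->
  {in pillars A, forall p, p \notin oitv I} ->
  exists A', [/\ admissible A', extends A' A &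
    exists2 p, p \in pillars A' & p \in oitv I].
Proof.
move=> [pA dA cA] II nI; have lI := interval_lt sysIs II.
have /and3P[I0 _ I1] := sysIs.1 I II.
(* [y] becomes the pillar that hits [I]; the greedy cuts alone might all miss [I]. *)
have [y /andP[Iy yI] yV] := avoid_finite (all_endpoints Is) lI.
have yin : y \in oitv I by rewrite in_itv /= Iy.
have yP : y \notin pillars A by apply/negP => /nI; rewrite yin.
have [|K [yK eK nK K0 K1]] := @gap_exists R (pillars A) y _ yP.
  by rewrite (le_lt_trans I0 Iy) (lt_le_trans yI I1).
have lK : K.1 < K.2 by move: yK; rewrite in_itv /= => /andP[]; apply: lt_trans.
have aK : is_arch A K by split=> //; rewrite fsetUC.
pose S := (D - k * w)%N.
have S0 : (0 < S)%N by rewrite subn_gt0 levels_lt.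
have [s [ps sK sS sJ]] := greedy_cuts A sysIs S0 lK.
have dK : (degree Is A K <= D)%N by apply: dA => // p; apply: nK.
pose x := nth 0 (K.1 :: s).
have x_mono i j : (i <= j <= size s)%N -> x i <= x j.
  move=> /andP[+ js]; rewrite leq_eqVlt => /predU1P[->//|ij]; apply: ltW.
  have sorted_s : sorted <%R (K.1 :: s) by [].
  by apply: (sorted_ltn_nth lt_trans 0 sorted_s); rewrite ?inE//= ltnS ltnW// (leq_trans ij).
have xr : x (size s) <= K.2.
  rewrite /x -last_nth; case: (s) sK => [_|z t sK] /=; first exact: ltW.
  by have [/ltW] := sK _ (mem_last z t).
(* The successor makes room for [y] beside the greedy cuts. *)
have szs : ((size s).+1 < 2 ^ k)%N.
  apply: few_cuts.
  have := sum_degrees sysIs pA aK (lexx _ : K.1 <= x 0%N) xr x_mono.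
  have : (\sum_(i < size s) S <= \sum_(i < size s) degree Is A (x i, x i.+1))%N.
    by apply: leq_sum => i _; apply: sS.
  rewrite sum_nat_const card_ord => l1 l2.
  apply: (leq_trans (leq_trans l1 l2)).
  by apply: leq_add; [rewrite leq_mul2r leq_mul2l omega_w !orbT|apply: leq_mul].
have [||||A' [pA' eA' [sA' PA' cA'] dA' dA'out]] :=
    @split_arch R Is sysIs k A K (y :: s) S D pA aK.
- move=> q; rewrite inE => /predU1P[->|qs].
    split=> // J JI; apply: contra yV => yJ.
    by apply/all_endpointsP; exists J.
  have [qK qV] := sK q qs; split.
    have /allP/(_ q qs) : all (> K.1) s := order_path_min lt_trans ps.
    by rewrite in_itv /= qK => ->.
  by move=> J JI; apply: contra qV => qJ; apply/all_endpointsP; exists J.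
- exact: szs.
- move=> J J1 J2 Js; apply: sJ => // q qs; apply: Js.
  by rewrite inE qs orbT.
- exact: dK.
have kw : (k * omega Is <= k * w)%N by rewrite leq_mul2l omega_w orbT.
have sP : {in pillars A, forall p, p \in pillars A'} by case: eA' => /fsubsetP.
exists A'; split=> //; last by exists y => //; apply: sA'; rewrite mem_head.
split=> // [J J0 J1 JP|c /cA'[/cA//|cD]]; last first.
  by apply: leq_trans cD _; apply: leq_trans DT; rewrite leq_add2l.
(* A [J] free of the new pillars lies off [K], where degrees are unchanged, or inside [K] and
   between the cuts. *)
have [JK1|JK1] := leP J.2 K.1.
  by rewrite dA'out; [apply: dA => // p /sP/JP|left].
have [JK2|JK2] := leP K.2 J.1.
  by rewrite dA'out; [apply: dA => // p /sP/JP|right].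
have [KJ1 KJ2] := gap_maximal eK J0 J1 (fun p pP => JP p (sP p pP)) JK1 JK2.
apply: (leq_trans (dA' J KJ1 KJ2 _)).
  by move=> q qs; apply: JP; apply: sA'.
by rewrite -[X in (_ <= X)%N](subnK (ltnW levels_lt)) leq_add2l.
Qed.

Lemma admissible_completion A : admissible A ->
  exists A', [/\ admissible A', complete Is A' & extends A' A].
Proof.
pose unhit A := [fset I in Is | [forall p : pillars A, val p \notin oitv I]].
have unhitP A1 I : reflect (I \in Is /\ {in pillars A1, forall p, p \notin oitv I})
    (I \in unhit A1).
  rewrite in_fset_sep; apply: (iffP andP) => -[II nI]; split=> //.
    by move=> p pP; apply: (forallP nI [` pP]).
  by apply/forallP => p; apply: nI; apply: valP.
have [n] := ubnP #|` unhit A|; elim: n A => // n IH A; rewrite ltnS => An adA.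
have [unhit0|/fset0Pn[I IA]] := eqVneq (unhit A) fset0.
  exists A; split=> //; last exact: extends_refl.
  move=> I II; apply: contrapT => nI; suff : I \in unhit A by rewrite unhit0 in_fset0.
  by apply/unhitP; split=> // p pP; apply/negP => pI; apply: nI; exists p.
have [II nI] := unhitP _ _ IA.
have [A1 [adA1 eA1 [p pP pI]]] := admissible_step adA II nI.
have [|A2 [adA2 cA2 eA2]] := IH A1 _ adA1; last first.
  by exists A2; split=> //; apply: extends_trans eA2.
apply: leq_trans An; apply: (@fsubset_lt_card _ _ _ I) => // [J|].
  move=> /unhitP[JI nJ]; apply/unhitP; split=> // q qP; apply: nJ.
  by case: eA1 => /fsubsetP + _ _ _; apply.
by apply/unhitP => -[_ /(_ p pP)]; rewrite pI.
Qed.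

End Completion.

(** * Clique number of the graph, and the number of levels in logarithms *)

Lemma omega_le_clique_number (R : realType) (G : sgraph) (Is : {fset R * R}) :
  graph_iso G (overlap_graph Is) -> (omega Is <= clique_number G)%N.
Proof.
move=> [f [g fK gK] fadj]; apply: omega_le => Y /fsubsetP YI cY.
pose Y' := [set u : Is | val u \in Y].
have <- : #|g @: Y'| = #|` Y|.
  rewrite card_imset; last exact: can_inj gK.
  rewrite -(card_fset_image _ val_inj); congr #|` _|.
  apply/fsetP => I; apply/imfsetP/idP => [[u]|IY]; first by rewrite inE => + ->.
  by exists [` YI _ IY]; rewrite //= inE.
apply: (@leq_bigmax_cond _ (@is_clique G) (fun K : {set G} => #|K|)).
apply/forall_inP => _ /imsetP[u uY ->]; apply/forall_inP => _ /imsetP[v vY ->].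
apply/implyP => guv; rewrite -fadj !gK; apply/asboolP; apply: cY.
- by rewrite inE in uY.
- by rewrite inE in vY.
- by apply: contraNneq guv => /val_inj ->.
Qed.

Section Levels.
Variable R : realType.

(* The hypotheses say that a / b <= log2 w and 2^k <= 8 w a / b. *)
Lemma levels_le_log (w k a b : nat) : (0 < w)%N -> (0 < a)%N -> (0 < b)%N ->
  (2 ^ a <= w ^ b)%N -> (2 ^ k * b <= 8 * w * a)%N ->
  k%:R <= log2 (w%:R : R) + log2 (log2 (w%:R : R)) + 3.
Proof.
move=> w0 a0 b0 ab kab.
have ln2_gt0 : 0 < ln (2 : R) by rewrite ln_gt0// ltr1n.
have wR : 0 < w%:R :> R by rewrite ltr0n.
have bR : 0 < b%:R :> R by rewrite ltr0n.
have aR : 0 < a%:R :> R by rewrite ltr0n.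
set L := log2 (w%:R : R).
have LE : L * ln 2 = ln (w%:R : R) by rewrite /L /log2 divfK// gt_eqF.
clearbody L.
have abL : a%:R <= b%:R * L.
  have : ln ((2 ^ a)%:R : R) <= ln ((w ^ b)%:R : R).
    by rewrite ler_ln ?posrE ?ltr0n ?expn_gt0 ?w0// ler_nat.
  rewrite !natrX !lnXn ?ltr0n// -LE -[X in X <= _]mulr_natl -[X in _ <= X]mulr_natl mulrA.
  by rewrite ler_pM2r.
have L0 : 0 < L by rewrite -(pmulr_rgt0 _ bR); apply: lt_le_trans abL.
have kL : (2 ^ k)%:R <= 8 * w%:R * L.
  rewrite -(ler_pM2r bR) -[(2 ^ k)%:R * _]natrM.
  apply: (@le_trans _ _ (8 * w * a)%N%:R); first by rewrite ler_nat.
  by rewrite !natrM -!mulrA ler_pM2l ?ltr0n// ler_pM2l// [L * _]mulrC.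
have : ln ((2 ^ k)%:R : R) <= ln (8 * w%:R * L).
  by rewrite ler_ln ?posrE ?ltr0n ?expn_gt0// !mulr_gt0.
rewrite !lnM ?posrE ?mulr_gt0// -LE natrX lnXn ?ltr0n//.
(* The factor 8 turns into the summand 3 of the bound. *)
have -> : 8 = 2 ^+ 3 :> R by rewrite -natrX.
rewrite lnXn// -[ln 2 *+ k]mulr_natl -[ln 2 *+ 3]mulr_natl.
rewrite -[X in _ + X](divfK (lt0r_neq0 ln2_gt0)) -!mulrDl.
by rewrite ler_pM2r// /log2; lra.
Qed.

Lemma levels_exist (w : nat) : (2 <= w)%N -> exists k : nat,
  (w * (k + 3) + 2 <= 2 ^ k)%N /\
  k%:R <= log2 (w%:R : R) + log2 (log2 (w%:R : R)) + 3.
Proof.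
move=> w2; have [w8|w8] := ltnP w 8.
  (* For [w = 3] and [w = 7] the integer part of [log2 w] would give too few levels, so rational
     lower bounds such as 4/3 and 5/2 are used. *)
  case: w w2 w8 => [|[|[|[|[|[|[|[|//]]]]]]]] //= _ _.
  - by exists 4%N; split; last exact: (@levels_le_log _ _ 1 1).
  - by exists 5%N; split; last exact: (@levels_le_log _ _ 4 3).
  - by exists 6%N; split; last exact: (@levels_le_log _ _ 2 1).
  - by exists 6%N; split; last exact: (@levels_le_log _ _ 2 1).
  - by exists 6%N; split; last exact: (@levels_le_log _ _ 2 1).
  - by exists 7%N; split; last exact: (@levels_le_log _ _ 5 2).
have w0 : (0 < w)%N by lia.
pose n := trunc_log 2 w; pose k := trunc_log 2 (8 * w * n).
have n3 : (3 <= n)%N by apply: trunc_log_max.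
have nw : (2 ^ n <= w)%N by apply: trunc_logP.
have wn : (w < 2 ^ n.+1)%N by apply: trunc_log_ltn.
have kwn : (2 ^ k <= 8 * w * n)%N by apply: trunc_logP => //; nia.
have wnk : (8 * w * n < 2 ^ k.+1)%N by apply: trunc_log_ltn.
have n_exp : (n <= 2 ^ n.-1)%N.
  by rewrite -[X in (X <= _)%N](prednK (ltnW (ltnW n3))) ltn_expl.
have k2n : (k <= 2 * n + 2)%N.
  rewrite -ltnS -(ltn_exp2l _ _ (isT : (1 < 2)%N)); apply: leq_ltn_trans kwn _.
  have -> : ((2 * n + 2).+1 = 3 + n.+1 + n.-1)%N by lia.
  rewrite !expnD; set P1 := (2 ^ n.+1)%N in wn *; set P2 := (2 ^ n.-1)%N in n_exp *.
  nia.
exists k; split; last by apply: (@levels_le_log _ _ n 1) => //; rewrite ?expn1 ?muln1//; lia.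
(* Here [4 * w * n < 2 ^ k], while [k + 3 <= 2 * n + 5 <= 4 * n - 1] because [3 <= n]; the remaining
   [w] covers the 2. *)
by move: wnk; rewrite expnS; nia.
Qed.

End Levels.

Theorem theorem11 (R : realType) (w : nat) (G : sgraph) (Is : {fset R * R})
    (A : pillar_triple R) :
  (2 <= w)%N ->
  circle_graph R G ->
  (clique_number G <= w)%N ->
  interval_system Is ->
  graph_iso G (overlap_graph Is) ->
  pillar_assignment Is A ->
  (chi A)%:R <= 2 * w%:R * log2 (w%:R : R)
                + 2 * w%:R * log2 (log2 (w%:R : R)) + 10 * w%:R ->
  (forall K : R * R, is_arch A K ->
     (degree Is A K)%:R <= w%:R * log2 (w%:R : R)
                + w%:R * log2 (log2 (w%:R : R)) + 6 * w%:R) ->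
  exists A' : pillar_triple R,
    [/\ pillar_assignment Is A',
        complete Is A',
        extends A' A &
        (chi A')%:R <= 2 * w%:R * log2 (w%:R : R)
                + 2 * w%:R * log2 (log2 (w%:R : R)) + 10 * w%:R].
Proof.
move=> w2 _ Gw sysIs isoG pA chiA degA.
have w0 : (0 < w)%N by apply: ltnW.
have omega_w := leq_trans (omega_le_clique_number isoG) Gw.
have [k [k_large k_log]] := levels_exist R w2.
move: chiA degA k_log; set L := log2 (w%:R : R); set M := log2 L => chiA degA k_log.
pose DR := w%:R * L + w%:R * M + 6 * w%:R : R.
pose TR := 2 * w%:R * L + 2 * w%:R * M + 10 * w%:R : R.
have wR : 0 < w%:R :> R by rewrite ltr0n.
have kw_log : (k * w)%:R <= w%:R * L + w%:R * M + 3 * w%:R.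
  rewrite natrM (le_trans (_ : _ <= (L + M + 3) * w%:R))//; last by lra.
  by rewrite ler_wpM2r// ltW.
have kw0 : 0 <= (k * w)%:R :> R by apply: ler0n.
have DR0 : 0 <= DR by rewrite /DR; lra.
have TR0 : 0 <= TR by rewrite /TR; lra.
have leD n : (n <= Num.truncn DR)%N = (n%:R <= DR) by rewrite truncn_ge_nat.
have leT n : (n <= Num.truncn TR)%N = (n%:R <= TR) by rewrite truncn_ge_nat.
have DDR : (Num.truncn DR)%:R <= DR by rewrite -leD.
(* The constant 6 is spent here: 3 from the bound on [k] and 3 for the counting of pieces. *)
have kD : ((k + 3) * w <= Num.truncn DR)%N.
  by rewrite leD mulnDl natrD [(3 * w)%:R]natrM /DR; lra.
have DT : (Num.truncn DR + k * w <= Num.truncn TR)%N.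
  by rewrite leT natrD /TR; move: DDR; rewrite /DR; lra.
have [|A' [[pA' _ cA'] comA' eA']] :=
    @admissible_completion R Is w k _ _ sysIs w0 omega_w kD k_large DT A.
  split=> // [J J0 J1 JP|c /(colour_le_chi pA) cA]; last first.
    by rewrite leT; apply: le_trans chiA; rewrite ler_nat.
  (* The hypothesis speaks of arches only. A [J] of positive degree contains an endpoint, and the
     arch around that point contains [J]. *)
  have [->//|] := posnP (degree Is A J).
  rewrite {1}(surjective_pairing J) => /seen_endpoint[x].
  rewrite in_fset_sep => /andP[_ /andP[Jx xJ]].
  have [||K [xK eK nK _ _]] := @gap_exists R (pillars A) x.
  - by rewrite (le_lt_trans J0 Jx) (lt_le_trans xJ J1).
  - by apply/negP => /JP; rewrite in_itv /= Jx xJ.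
  move: xK; rewrite in_itv /= => /andP[Kx xK].
  have aK : is_arch A K by split; rewrite ?(lt_trans Kx)// fsetUC.
  have [KJ1 KJ2] := gap_maximal eK J0 J1 JP (lt_trans Kx xJ) (lt_trans Jx xK).
  by apply: leq_trans (degree_mono Is A KJ1 KJ2) _; rewrite leD; apply: degA.
exists A'; split=> //; rewrite -leT /chi.
(* All colours lie between 1 and the integer part of [TR], so there are at most that many. *)
rewrite -(size_iota 1 (Num.truncn TR)); apply: uniq_leq_size (fset_uniq _) _ => c cA.
by rewrite mem_iota add1n ltnS (colour_gt0 pA' cA) cA'.
Qed.
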